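(* Let $n\ge 2$ and $\mathfrak n\ge 1$ be integers and let $\mathbf s=\{s_{i_1,\dots,i_n}\}_{i_1,\dots,i_n=0}^{2\mathfrak n-2}$ be real numbers. For $J=(j_2,\dots,j_n)\in\{0,\dots,2\mathfrak n-2\}^{n-1}$ let $\mathfrak s_J=\{\mathfrak s_{i,j_2,\dots,j_n}\}_{i=0}^{2\mathfrak n-2}$ be the associated sequence. Suppose that for every $J$ the number $\mathfrak n$ is a normal index of $\mathfrak s_J$ and $\mathfrak s_J$ is regular. Let $n_1^{J}<\dots<n_{N_J}^{J}=\mathfrak n$ be the normal indices of $\mathfrak s_J$, and let $m_k^{J},l_k^{J}$ be its S-fraction atoms and $P^{+J}_{k},Q^{+J}_{k}$ its Stieltjes polynomials of the first and second kind (all defined in the context). Then any solution $F$ of the problem $\mathbf{MP}(\mathbf s,2\mathfrak n-2)$ has the representation $$F(z_1,\dots,z_n)=\sum_{j_2,\dots,j_n=0}^{2\mathfrak n-2}\frac{1}{\prod_{i=2}^n z_i^{j_i+1}}\cdot\cfrac{1}{-z_1m_1^{J}(z_1)+\cfrac{1}{l_1^{J}+\cdots+\cfrac{1}{-z_1m_{N_J}^{J}(z_1)+\cfrac{1}{\tau_J(z_1)}}}},$$ where the parameters $\tau_J$ satisfy $\dfrac1{\tau_J(z_1)}=o(z_1)$ as $z_1\widehat{\rightarrow}\infty$. Furthermore, this representation can be rewritten as $$F(z_1,\dots,z_n)=\sum_{j_2,\dots,j_n=0}^{2\mathfrak n-2}\frac{1}{\prod_{i=2}^n z_i^{j_i+1}}\;\frac{Q^{+J}_{2N_J-1}(z_1)\,\tau_J(z_1)+Q^{+J}_{2N_J-2}(z_1)}{P^{+J}_{2N_J-1}(z_1)\,\tau_J(z_1)+P^{+J}_{2N_J-2}(z_1)}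 .$$
   Context: **Limits.** A Stolz domain with centre $0$ and angle $\theta\in(0,\pi/2]$ is $\{z\in\mathbb C^+:\theta<\arg z<\pi-\theta\}$; $z\widehat{\rightarrow}\infty$ means $|z|\to\infty$ inside any such Stolz domain. Identities between functions of $z_1$ are understood for $z_1$ in any such Stolz domain with $|z_1|$ sufficiently large (depending on the domain), and $z_2,\dots,z_n\neq0$. The value $\tau_J(z_1)=\infty$, i.e. $1/\tau_J(z_1)=0$, is allowed, the linear fractional expression being then read as $Q^{+J}_{2N_J-1}/P^{+J}_{2N_J-1}$. **Associated sequences.** For $J=(j_2,\dots,j_n)$, $$\mathfrak s_{i,j_2,\dots,j_n}=\binom{i+j_2+\dots+j_n}{i,j_2,\dots,j_n}s_{i,j_2,\dots,j_n}\quad(\text{multinomial coefficient}).$$ **The problem $\mathbf{MP}(\mathbf s,\ell)$.** Given real numbers $\mathbf s=\{s_{i_1,\dots,i_n}\}_{i_1,\dots,i_n=0}^{\ell}$, a solution is a function of the form $$F(z_1,\dots,z_n)=\sum_{j_2,\dots,j_n=0}^{\ell}\frac{F_{j_2,\dots,j_n}(z_1)}{z_2^{j_2+1}\cdots z_n^{j_n+1}},$$ where each $F_{J}$ is a complex function on $\mathbb C^+$ with $$F_J(z_1)=-\frac{\mathfrak s_{0,j_2,\dots,j_n}}{z_1}-\dots-\frac{\mathfrak s_{\ell,j_2,\dots,j_n}}{z_1^{\ell+1}}+o\left(\frac1{z_1^{\ell+1}}\right),\quad z_1\widehat{\rightarrow}\infty .$$ **Objects attached to a one-dimensional real sequence**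 $c=\{c_i\}_{i=0}^{2\mathfrak n-2}$ (applied to $c=\mathfrak s_J$, the superscript $J$ indicating the sequence). *Normal indices:* the integers $m$, $1\le m\le\mathfrak n$, with $D_m:=\det(c_{p+q})_{p,q=0}^{m-1}\ne0$. List them as $n_1<\dots<n_N$; assume $n_N=\mathfrak n$; put $n_0=0$ and $\nu_k=n_k-n_{k-1}$. *Regularity:* $c$ is regular if $D^+_{n_j-1}\neq0$ for every $j\le N$, where $D^+_m=\det(c_{p+q+1})_{p,q=0}^{m-1}$ and $D_0^+=1$. *P-fraction atoms:* Put $c^{(0)}_i=c_i$. For $k=1,\dots,N-1$ and $0\le i\le 2\mathfrak n-2n_k-2$, $$c^{(k)}_i=\frac{(-1)^{i+\nu_k}}{\big(c^{(k-1)}_{\nu_k-1}\big)^{i+\nu_k+1}}\det(T_{pq})_{p,q=1}^{i+\nu_k+1},\qquad T_{pq}=\begin{cases}c^{(k-1)}_{\nu_k+p-q},&q\le p+1,\\0,&q>p+1.\end{cases}$$ For $k=0,\dots,N-1$, with $\nu=\nu_{k+1}$ and $D^{(k)}_\nu=\det(c^{(k)}_{p+q})_{p,q=0}^{\nu-1}$, $$b_k=c^{(k)}_{\nu-1},\qquad a_k(z)=\frac1{D^{(k)}_\nu}\begin{vmatrix}c^{(k)}_0&c^{(k)}_1&\dots&c^{(k)}_\nu\\ \vdots&\vdots&&\vdots\\ c^{(k)}_{\nu-1}&c^{(k)}_\nu&\dots&c^{(k)}_{2\nu-1}\\1&z&\dots&z^\nu\end{vmatrix}.$$ For $k=N-1$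 the entry $c^{(N-1)}_{2\nu_N-1}$ is not determined by the data; give it an arbitrary real value (only $a_{N-1}(z)-a_{N-1}(0)$ is used below, and this does not depend on the choice). *S-fraction atoms:* $$d_1=\frac1{b_0},\qquad l_1=-\frac1{d_1a_0(0)},\qquad d_j=\frac1{b_{j-1}\,l_{j-1}^2\,d_{j-1}},\qquad l_j=-\frac{l_{j-1}}{1+l_{j-1}d_ja_{j-1}(0)},$$ $$m_j(z)=\frac{(a_{j-1}(z)-a_{j-1}(0))\,d_j}{z},$$ with $d_j,m_j$ for $1\le j\le N$ and $l_j$ for $1\le j\le N-1$; $d_j$ is the leading coefficient of $m_j$. *Stieltjes polynomials:* $P^+_k$ and $Q^+_k$ ($-1\le k\le 2N-1$) are the solutions of $$y_{2j}-y_{2j-2}=l_j\,y_{2j-1},\qquad y_{2j+1}-y_{2j-1}=-z\,m_{j+1}(z)\,y_{2j}$$ with $P^+_{-1}\equiv0$, $P^+_0\equiv1$, $Q^+_{-1}\equiv1$, $Q^+_0\equiv0$. *)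

(* Defs.v *)
From mathcomp Require Import all_boot all_order all_algebra.
From mathcomp Require Import all_classical all_reals all_analysis.
From mathcomp.real_closed Require Export complex.

Set Implicit Arguments.
Unset Strict Implicit.
Unset Printing Implicit Defensive.

Import Order.TTheory GRing.Theory Num.Theory.
Import numFieldNormedType.Exports.

Local Open Scope classical_set_scope.
Local Open Scope ring_scope.
Local Open Scope complex_scope.

Section Limits.
Variable R : realType.
Local Notation C := R[i].

Definition upper_half_plane : set C := [set z | 0 < complex.Im z].

(* theta < arg z < pi - theta, in polar form *)
Definition stolz (theta : R) : set C :=
  [set z | upper_half_plane z /\
     exists2 phi : R, theta < phi < pi - theta
                    & z = `|z| * (cos phi +i* sin phi)].

(* |z| -> oo inside the Stolz domain; for theta = pi / 2 the domain is empty,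
   so this filter is not proper and everything holds near it. *)
Definition stolz_infty (theta : R) : set_system C :=
  within (stolz theta)
    (filter_from setT (fun M : R => [set z : C | M%:C < `|z|])).

Global Instance stolz_infty_filter theta : Filter (stolz_infty theta).
Proof.
apply/within_filter/filter_from_filter; first by exists 0.
move=> x y _ _; exists (Order.max x y) => // z /=.
by move=> h; split; apply: le_lt_trans h; rewrite lecR le_max lexx ?orbT.
Qed.

Canonical stolz_infty_filter_on theta :=
  FilterType (stolz_infty theta) (stolz_infty_filter theta).

(* The cast gives access to the normed structure of C over itself. *)
Definition stolz_littleo (f g : C -> (C : numFieldType)) : Prop :=
  forall theta : R, 0 < theta <= pi / 2 -> f =o_ (stolz_infty theta) g.

End Limits.

Section OneDimensional.
Variable R : realType.
Variables (nn : nat) (c : nat -> R).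
(* c stands for c_0, ..., c_(2 nn - 2); its other values are irrelevant.
   The value e is the arbitrary choice of c^(N-1)_(2 nu_N - 1). *)
Variable e : R.

(* Both are 1 for m = 0. *)
Definition hankel (u : nat -> R) (m : nat) : R :=
  \det (\matrix_(p < m, q < m) u (p + q)%N).
Definition hankel_plus (u : nat -> R) (m : nat) : R :=
  \det (\matrix_(p < m, q < m) u (p + q).+1%N).

Definition is_normal_index (m : nat) : bool :=
  (1 <= m <= nn)%N && (hankel c m != 0).

(* n_1 < ... < n_N *)
Definition normal_indices : seq nat :=
  [seq m <- iota 1 nn | is_normal_index m].

Definition num_normal : nat := size normal_indices.

Definition normal_index (k : nat) : nat := nth 0%N (0%N :: normal_indices) k.

Definition nu (k : nat) : nat := (normal_index k - normal_index k.-1)%N.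

Definition regular : Prop :=
  forall j, (1 <= j <= num_normal)%N ->
    hankel_plus c (normal_index j).-1 != 0.

(* c^(k)_i, for k < N and i <= 2 nn - 2 n_k - 2 *)
Fixpoint derived_seq (k i : nat) : R :=
  if k is k'.+1 then
    let v := nu k in
    (-1) ^+ (i + v)%N / derived_seq k' v.-1 ^+ (i + v).+1%N *
    \det (\matrix_(p < (i + v).+1, q < (i + v).+1)
            if (q <= p.+1)%N then derived_seq k' (v + p - q)%N else 0)
  else c i.

Definition derived_seq_ext (k i : nat) : R :=
  if (k.+1 == num_normal) && (i == (nu num_normal).*2.-1) then e
  else derived_seq k i.

Definition patom_b (k : nat) : R := derived_seq k (nu k.+1).-1.

Definition patom_a (k : nat) : {poly R} :=
  let v := nu k.+1 in
  (hankel (derived_seq k) v)^-1 *: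
  \det (\matrix_(p < v.+1, q < v.+1)
          if (p < v)%N then (derived_seq_ext k (p + q)%N)%:P else 'X^q).

(* (d_(j+1), l_(j+1)) *)
Fixpoint satom_dl (j : nat) : R * R :=
  if j is j'.+1 then
    let: (d', l') := satom_dl j' in
    let d := 1 / (patom_b j * l' ^+ 2 * d') in
    (d, - (l' / (1 + l' * d * (patom_a j).[0])))
  else
    let d := 1 / patom_b 0 in (d, - (1 / (d * (patom_a 0).[0]))).

Definition satom_d (j : nat) : R := (satom_dl j.-1).1.
Definition satom_l (j : nat) : R := (satom_dl j.-1).2.

(* The division by 'X is exact. *)
Definition satom_m (j : nat) : {poly R} :=
  (satom_d j *: (patom_a j.-1 - ((patom_a j.-1).[0])%:P)) %/ 'X.

(* (y_(2j-1), y_(2j)) from (y_(-1), y_0) *)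
Fixpoint stieltjes_rec (y : {poly R} * {poly R}) (j : nat)
    : {poly R} * {poly R} :=
  if j is j'.+1 then
    let: (yodd, yeven) := stieltjes_rec y j' in
    let yodd' := yodd - 'X * satom_m j * yeven in
    (yodd', yeven + satom_l j *: yodd')
  else y.

(* Polynomials of index 2j - 1 and 2j; only l_1, ..., l_(j-1) enter the
   former. *)
Definition P_odd (j : nat) : {poly R} := (stieltjes_rec (0, 1) j).1.
Definition P_even (j : nat) : {poly R} := (stieltjes_rec (0, 1) j).2.
Definition Q_odd (j : nat) : {poly R} := (stieltjes_rec (1, 0) j).1.
Definition Q_even (j : nat) : {poly R} := (stieltjes_rec (1, 0) j).2.

Local Notation C := R[i].

Definition ceval (p : {poly R}) (z : C) : C := (map_poly (real_complex R) p).[z].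

(* A parameter value is a point of C with infinity, None being infinity;
   The true reciprocal of 0 is infinity, so param_inv is meaningful only where
   the parameter is nonzero, which inv_littleo_id below guarantees far out. *)
Definition param_inv (t : option C) : C := if t is Some w then w^-1 else 0.

(* With N = k + r, the denominator
   - z m_k + 1 / (l_k + 1 / (... + 1 / (- z m_N + 1 / tau))) *)
Fixpoint cfrac_den (z : C) (t : option C) (r k : nat) : C :=
  - z * ceval (satom_m k) z +
  (if r is r'.+1 then 1 / ((satom_l k)%:C + 1 / cfrac_den z t r' k.+1)
   else param_inv t).

Definition cfrac (z : C) (t : option C) : C :=
  1 / cfrac_den z t num_normal.-1 1.

(* No denominator of the continued fraction vanishes. *)
Definition cfrac_defined (z : C) (t : option C) : Prop :=
  (forall k, (1 <= k <= num_normal)%N ->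
     cfrac_den z t (num_normal - k) k != 0) /\
  (forall k, (1 <= k < num_normal)%N ->
     (satom_l k)%:C + 1 / cfrac_den z t (num_normal - k.+1) k.+1 != 0).

Definition linfrac_den (z : C) (t : option C) : C :=
  if t is Some w then
    ceval (P_odd num_normal) z * w + ceval (P_even num_normal.-1) z
  else ceval (P_odd num_normal) z.

Definition linfrac_num (z : C) (t : option C) : C :=
  if t is Some w then
    ceval (Q_odd num_normal) z * w + ceval (Q_even num_normal.-1) z
  else ceval (Q_odd num_normal) z.

Definition linfrac (z : C) (t : option C) : C :=
  linfrac_num z t / linfrac_den z t.

End OneDimensional.

Section MomentProblem.
Variable R : realType.
Local Notation C := R[i].
(* The variables are (z_1, z) with z = (z_2, ..., z_n), and the indices
   (i_1, J) with J = (j_2, ..., j_n). *)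
Variables (n ell : nat).

Definition multi_index : finType := {ffun 'I_n.-1 -> 'I_ell.+1}.

Variable s : 'I_ell.+1 -> multi_index -> R.

Definition multinomial (i : nat) (J : multi_index) : R :=
  ((i + \sum_k J k)`!)%N%:R / (i`! * \prod_k (J k)`!)%N%:R.

(* For i > ell the value is a dummy one. *)
Definition assoc_seq (J : multi_index) (i : nat) : R :=
  multinomial i J * s (inord i) J.

Definition monomial_weight (J : multi_index) (z : 'I_n.-1 -> C) : C :=
  1 / \prod_k z k ^+ (J k).+1.

Definition MP_solution (F : C -> ('I_n.-1 -> C) -> C) : Prop :=
  exists FJ : multi_index -> C -> C,
    (forall (z1 : C) (z : 'I_n.-1 -> C),
       upper_half_plane z1 -> (forall k, z k != 0) ->
       F z1 z = \sum_J FJ J z1 / \prod_k z k ^+ (J k).+1) /\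
    (forall J : multi_index,
       stolz_littleo
         (fun z1 => FJ J z1 -
            (- \sum_(i < ell.+1) (assoc_seq J i)%:C / z1 ^+ i.+1))
         (fun z1 => 1 / z1 ^+ ell.+1)).

End MomentProblem.

(* 1 / tau = o(z): in particular 1 / tau is finite far out in each Stolz
   domain. *)
Definition inv_littleo_id (R : realType) (tau : R[i] -> option R[i]) : Prop :=
  (forall theta : R, 0 < theta <= pi / 2 ->
     \forall z \near stolz_infty theta, tau z != Some 0) /\
  stolz_littleo (fun z => param_inv (tau z)) (fun z => z).

(* Main.v *)
Require Import Defs.
From mathcomp Require Import all_boot all_order all_algebra.
From mathcomp Require Import all_classical all_reals all_analysis.
From mathcomp Require Import perm zify ring.

Set Implicit Arguments.
Unset Strict Implicit.
Unset Printing Implicit Defensive.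

Import Order.TTheory GRing.Theory Num.Theory.
Import numFieldNormedType.Exports.

Local Open Scope classical_set_scope.
Local Open Scope ring_scope.
Local Open Scope complex_scope.

(** The components [FJ J] of a solution are independent of each other, so it
suffices to treat one function [f] with an expansion [- sum c_i / z^(i+1)] up
to [o(z^(-(2 nn - 1)))], for one real sequence [c].

Formally, let [c(z) = sum c_i / z^(i+1)] with first nonzero coefficient [b] at
index [v - 1]. Then [c = b / (a - c1)], where the monic polynomial [a] of
degree [v] and the tail [c1] are read off the coefficients of [1 / c]. These
coefficients are Toeplitz-Hessenberg determinants
([det_toeplitz_hessenberg]), so [c1] is the derived sequence
([pfrac_next_det]); solving a Hankel system by Cramer's rule shows that [a] is
the P-fraction atom ([pfrac_quot_det]). The identity [c * (a - c1) = b] is used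
in the polynomial form [size_pfrac_step], where an error term is a bound on the
size of a polynomial.

Two facts about determinants are needed. Multiplying the Hankel matrix of [c]
by a triangular Toeplitz matrix built from [1 / c] makes it block triangular,
whence the determinant of order [v + m] for [c] vanishes exactly when that of
order [m] for [c1] does ([hankel_det_step]); by induction the [nu_k] defined by
the normal indices are the orders of the successive derived sequences
([hankel_derived]). Next, the denominators [P_j] of the P-fraction satisfy
[P_j(0) <> 0] for [j < N]: the polynomial [P_j] has degree [n_j] and is
orthogonal to all polynomials of degree smaller than [n_(j+1) - 1], so that
[P_j = X q] would put [q] in the kernel of the shifted Hankel matrix of order
[n_(j+1) - 1], against regularity ([continuant_neq0]). As
[1 / l_j = - d_j P_j(0) / P_(j-1)(0)], all S-fraction atoms are well defined and
nonzero ([satomE]).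

On the analytic side, put [f_0 = f] and [f_(k+1) = - b_k / f_k - a_k]. By the
formal identity, [f_k] has an expansion with the coefficients of the [k]-th
derived sequence, valid up to the order which the data determine
([expansion_tail]), and the last tail satisfies [f_N = o(z)]
([pfrac_tail_last]). The parameter is defined by
[1 / tau = - 1 / l_(N-1) - d_N a_(N-1)(0) - d_N f_N], hence is [o(z)]. At a
fixed point [z], the [k]-th denominator of the continued fraction is
[- 1 / l_(k-1) - d_k (a_(k-1) + f_k)] ([cfrac_denE]), which gives the value
[1 / f] at [k = 1]; the linear fractional form follows from the two-term
recurrences of the Stieltjes polynomials ([stieltjes_tailS]). No denominator
vanishes far out, because [f_k] has a nonzero leading coefficient and tends to
[0] for [1 <= k < N], while [1 / l_k] is nonzero. *)

(** * Reciprocals of power series *)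

Lemma sum_nat_eq0 (V : nmodType) m n (f : nat -> V) :
  (forall i, (m <= i < n)%N -> f i = 0) -> \sum_(m <= i < n) f i = 0.
Proof. by move=> f0; rewrite big_nat big1. Qed.

Section Recip.
Variables (F : fieldType) (u : nat -> F).

(** Coefficients of [1 / (sum u_i x^i)]. The recursion is on the fuel [n] and
gives the coefficient of index [i] as soon as [i < n]. *)
Fixpoint recip_rec (n i : nat) : F :=
  if n is n'.+1 then
    ((i == 0%N)%:R - \sum_(s < i) u s.+1 * recip_rec n' (i - s.+1)%N) / u 0%N
  else 0.

Definition recip (i : nat) : F := recip_rec i.+1 i.

Lemma recip_rec_fuel n i : (i < n)%N -> recip_rec n i = recip i.
Proof.
rewrite /recip.
elim: n {-2}n (leqnn n) i => [|N IH] [|n] // lenN i lein.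
rewrite [LHS]/= [RHS]/=; congr ((_ - _) / _).
apply: eq_bigr => s _; congr (_ * _).
case: i lein s => [|i] lein s; first by case: s.
have hs := ltn_ord s; rewrite IH //; last by lia.
by rewrite [RHS]IH //; lia.
Qed.

Hypothesis u0 : u 0%N != 0.

Lemma recipP i : \sum_(s < i.+1) u s * recip (i - s)%N = (i == 0%N)%:R.
Proof.
rewrite big_ord_recl subn0 {1}/recip /= mulrC divfK //.
rewrite [X in _ - X + _](eq_bigr (fun s : 'I_i => u s.+1 * recip (i - s.+1)%N)).
  by rewrite subrK.
by move=> s _; congr (_ * _); apply: recip_rec_fuel; have := ltn_ord s; lia.
Qed.

Lemma recip0 : recip 0 = (u 0%N)^-1.
Proof. by rewrite /recip /= big_ord0 subr0 div1r. Qed.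

(** Wronski's formula: the convolution identities for [1 / u] say that the
matrix sends the vector of the first [n] coefficients to a multiple of the last
basis vector, and Cramer's rule then gives the next coefficient. *)
Lemma det_toeplitz_hessenberg n :
  \det (\matrix_(p < n, q < n) if (q <= p.+1)%N then u (p.+1 - q)%N else 0) =
  (-1) ^+ n * u 0%N ^+ n.+1 * recip n.
Proof.
case: n => [|n]; first by rewrite det_mx00 expr0 expr1 mul1r recip0 divff.
set T := (\matrix_(_, _) _).
pose w : 'cV[F]_n.+1 := \col_q recip q.
have Tw : T *m w = (- (u 0%N * recip n.+1)) *: delta_mx ord_max 0.
  apply/matrixP => p j; rewrite !mxE {j}(ord1 j) eqxx andbT.
  have full := recipP p.+1; rewrite [_%:R]/= in full.
  transitivity (\sum_(q < n.+1 | (q <= p.+1)%N) u (p.+1 - q)%N * recip q).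
    rewrite [RHS]big_mkcond /=; apply: eq_bigr => q _; rewrite !mxE.
    by case: ifP => //; rewrite mul0r.
  rewrite -(big_mkord (fun q => (q <= p.+1)%N) (fun q => u (p.+1 - q)%N * recip q)).
  have {full} : \sum_(0 <= q < p.+2) u (p.+1 - q)%N * recip q = 0.
    rewrite big_nat_rev /= big_mkord -[RHS]full; apply: eq_bigr => s _.
    by have := ltn_ord s => hs; congr (u _ * recip _); lia.
  have hp := ltn_ord p.
  have [ltpn|lenp] := ltnP p n.
    move=> E; rewrite (big_cat_nat (n := p.+2)) //=.
    rewrite [X in X + _]big_nat_cond (eq_bigl (fun i => (0 <= i < p.+2)%N)); last by move=> i; lia.
    rewrite -big_nat E [X in _ + X]big_nat_cond big_pred0 ?addr0; last by move=> i; lia.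
    by rewrite -val_eqE /= (ltn_eqF ltpn) mulr0.
  have -> : p = ord_max by apply/val_inj => /=; lia.
  rewrite eqxx mulr1 big_nat_recr //= subnn => /eqP; rewrite addr_eq0 => /eqP <-.
  rewrite big_nat_cond [RHS]big_nat; apply: eq_bigl => i; lia.
have := congr1 (mulmx (\adj T)) Tw.
rewrite mulmxA mul_adj_mx mul_scalar_mx => /matrixP /(_ 0 0).
rewrite -scalemxAr !mxE recip0 (bigD1 ord_max) //= !mxE eqxx mulr1.
rewrite big1 ?addr0; last first.
  by move=> q /negbTE qm; rewrite !mxE qm mulr0.
(* The minor is lower triangular with diagonal entries u_0. *)
rewrite /cofactor addn0 [\det (row' _ _)]det_trig; last first.
  apply/is_trig_mxP => i j ltij; rewrite !mxE ifF //= /bump.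
  have hi : (i < n)%N := ltn_ord i.
  by rewrite leq0n (leqNgt n i) hi /= add0n add1n ltnS leqNgt ltij.
rewrite [\prod_(i < _) _](eq_bigr (fun=> u 0%N)); last first.
  move=> i _; have hi : (i < n)%N := ltn_ord i; rewrite !mxE /= /bump leq0n (leqNgt n i) hi.
  by rewrite /= add0n add1n leqnn subnn.
rewrite prodr_const card_ord => E.
rewrite -[LHS](mulfK (invr_neq0 u0)) E invrK !exprS; ring.
Qed.

End Recip.

(** The polynomial part of [X^n * sum u_i / X^i]. *)
Definition rev_trunc (F : fieldType) (n : nat) (u : nat -> F) : {poly F} :=
  \poly_(i < n.+1) u (n - i)%N.

Lemma coef_mul_rev_trunc (F : fieldType) (u v : nat -> F) n m i :
  (i <= n)%N -> (i <= m)%N ->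
  (rev_trunc n u * rev_trunc m v)`_(n + m - i) =
  \sum_(s < i.+1) u s * v (i - s)%N.
Proof.
move=> lein leim; rewrite coefM.
rewrite -(big_mkord xpredT (fun j => (rev_trunc n u)`_j * (rev_trunc m v)`_(n + m - i - j))).
rewrite (big_cat_nat (n := (n - i)%N)) //=; last by lia.
rewrite [X in X + _]sum_nat_eq0 ?add0r; last first.
  move=> j hj; rewrite (coef_poly m.+1) ifF ?mulr0 //; lia.
rewrite (big_cat_nat (n := n.+1)) /=; [|lia|lia].
rewrite [X in _ + X]sum_nat_eq0 ?addr0; last first.
  move=> j hj; rewrite coef_poly ifF ?mul0r //; lia.
rewrite big_nat_rev -{1}[(n - i)%N]add0n big_addn.
have -> : (n.+1 - (n - i) = i.+1)%N by lia.
rewrite big_mkord; apply: eq_bigr => s _; have hs := ltn_ord s.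
rewrite !coef_poly ifT; last by lia.
by rewrite ifT; [congr (u _ * v _); lia|lia].
Qed.

(** * One step of the P-fraction *)

(** The same determinant as [hankel], over an arbitrary field. *)
Definition hankel_det (F : fieldType) (c : nat -> F) (m : nat) : F :=
  \det (\matrix_(p < m, q < m) c (p + q)%N).

(** One step [c(z) = b / (a(z) - c1(z))] of the P-fraction of
[c(z) = sum c_i / z^(i+1)], whose first nonzero coefficient [b] has index
[v - 1]. *)
Section PFractionStep.
Variables (F : fieldType) (c : nat -> F) (v : nat).

Let u (i : nat) : F := c (v.-1 + i)%N.
Let b : F := c v.-1.
Let r : nat -> F := recip u.

(** The partial denominator [a]: the polynomial part of [b / c(z)]. *)
Definition pfrac_quot : {poly F} := b *: rev_trunc v r.

(** The sequence [c1] of the tail: [- c1(z)] is the part of [b / c(z)] with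
negative powers of [z]. *)
Definition pfrac_next (i : nat) : F := - b * r (v + i).+1%N.

Hypothesis v_gt0 : (0 < v)%N.
Hypothesis c_lt : forall i, (i < v.-1)%N -> c i = 0.
Hypothesis b_neq0 : b != 0.

Let u_neq0 : u 0%N != 0. Proof. by rewrite /u addn0. Qed.

Let r0 : r 0%N = b^-1.
Proof. by rewrite /r recip0 // /u addn0. Qed.

Lemma pfrac_next_det i :
  (-1) ^+ (i + v)%N / c v.-1 ^+ (i + v).+1%N *
  \det (\matrix_(p < (i + v).+1, q < (i + v).+1)
          if (q <= p.+1)%N then c (v + p - q)%N else 0) = pfrac_next i.
Proof.
rewrite -/b /pfrac_next.
transitivity ((-1) ^+ (i + v)%N / b ^+ (i + v).+1%N *
  ((-1) ^+ (i + v).+1 * u 0%N ^+ (i + v).+2 * r (i + v).+1)).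
  congr (_ * _); rewrite -det_toeplitz_hessenberg //; congr (\det _).
  apply/matrixP => p q; rewrite !mxE; case: ifP => // leqp.
  by rewrite /u; congr c; lia.
rewrite {1}/u addn0 -/b [in RHS]addnC.
rewrite [b ^+ _.+2]exprS [(-1) ^+ _.+1]exprS.
have h : b ^+ (i + v).+1 != 0 by rewrite expf_neq0.
have s1 : (-1) ^+ (i + v) * (-1) ^+ (i + v) = 1 :> F.
  by rewrite -exprMn mulrNN mulr1 expr1n.
move: (b ^+ (i + v).+1) h ((-1) ^+ (i + v)) s1 (r (i + v).+1) => B h e s1 x.
transitivity (- b * x * (e * e) * (B / B)); first by ring.
by rewrite s1 divff // !mulr1.
Qed.

(** For a row index [i < v] the missing terms of the convolution of [c] and
[r] vanish, so the sum is a coefficient of the constant series [1]. *)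
Lemma pfrac_conv i j : (i < v)%N ->
  \sum_(t < j.+1) c (i + t)%N * r (j - t)%N = (i + j == v.-1)%N%:R.
Proof.
move=> ltiv; rewrite -(big_mkord xpredT (fun t => c (i + t)%N * r (j - t)%N)).
have [ltv|lev] := ltnP (i + j) v.-1.
  rewrite (ltn_eqF ltv) sum_nat_eq0 // => t ht; rewrite c_lt ?mul0r //; lia.
rewrite (big_cat_nat (n := (v.-1 - i)%N)) /=; [|lia|lia].
rewrite [X in X + _]sum_nat_eq0 ?add0r; last first.
  by move=> t ht; rewrite c_lt ?mul0r //; lia.
have := recipP u_neq0 (i + j - v.-1)%N.
have -> : (i + j - v.-1 == 0)%N = (i + j == v.-1)%N by apply/eqP/eqP; lia.
move=> <-; rewrite -{1}[(v.-1 - i)%N]add0n big_addn.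
have -> : (j.+1 - (v.-1 - i) = (i + j - v.-1).+1)%N by lia.
rewrite big_mkord; apply: eq_bigr => s _; have hs := ltn_ord s.
by rewrite /u; congr (c _ * r _); lia.
Qed.

(** For a row index [v + i] the truncated convolution is minus its missing
part, which involves the coefficients of [c1]. *)
Lemma pfrac_conv_tail i j :
  \sum_(t < (v + j).+1) c (v + i + t)%N * r (v + j - t)%N =
  b^-1 * \sum_(t < i.+1) u (i - t)%N * pfrac_next (t + j)%N.
Proof.
have := recipP u_neq0 (i.+1 + v + j)%N; rewrite [_%:R]/=.
rewrite -(big_mkord xpredT (fun t => u t * r (i.+1 + v + j - t)%N)).
rewrite (big_cat_nat (n := i.+1)) /=; [|lia|lia].
rewrite addrC => /eqP; rewrite addr_eq0 => /eqP E.
transitivity (\sum_(i.+1 <= t < (i.+1 + v + j).+1) u t * r (i.+1 + v + j - t)%N).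
  rewrite -{1}[i.+1]add0n big_addn.
  have -> : ((i.+1 + v + j).+1 - i.+1 = (v + j).+1)%N by lia.
  rewrite big_mkord; apply: eq_bigr => s _; have hs := ltn_ord s.
  by rewrite /u; congr (c _ * r _); lia.
rewrite E big_nat_rev big_mkord -sumrN mulr_sumr; apply: eq_bigr => s _.
have hs := ltn_ord s; rewrite /pfrac_next.
have -> x y : b^-1 * (x * (- b * y)) = - (x * y) by field.
by congr (- (u _ * r _)); lia.
Qed.

(** The Hankel matrix [H] of order [v + m] times the triangular Toeplitz
matrix [U] of [r] is block lower triangular: the upper left block is the
antidiagonal permutation matrix, and the lower right one is, up to a nonzero
factor, the product of a triangular matrix and the Hankel matrix of [c1]. *)
Lemma hankel_det_step m :
  (hankel_det c (v + m) != 0) = (hankel_det pfrac_next m != 0).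
Proof.
pose H : 'M[F]_(v + m) := \matrix_(p, q) c (p + q)%N.
pose U : 'M[F]_(v + m) := \matrix_(t, j) if (t <= j)%N then r (j - t)%N else 0.
have HU i j : (H *m U) i j = \sum_(t < j.+1) c (i + t)%N * r (j - t)%N.
  rewrite mxE -(big_mkord xpredT (fun t => c (i + t)%N * r (j - t)%N)).
  transitivity (\sum_(0 <= t < v + m) c (i + t)%N * (if (t <= j)%N then r (j - t)%N else 0)).
    by rewrite big_mkord; apply: eq_bigr => t _; rewrite !mxE.
  rewrite (big_cat_nat (n := j.+1)) //=.
  rewrite [X in _ + X]sum_nat_eq0 ?addr0; last first.
    by move=> t ht; rewrite ifF ?mulr0 //; lia.
  by rewrite !big_nat; apply: eq_bigr => t ht; rewrite ifT //; lia.
have dU : \det U != 0.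
  rewrite -det_tr det_trig.
    by apply/prodf_neq0 => i _; rewrite !mxE leqnn subnn r0 invr_eq0.
  by apply/is_trig_mxP => i j ltij; rewrite !mxE leqNgt ltij.
have ur0 : ursubmx (H *m U) = 0.
  apply/matrixP => i j; rewrite 2!mxE HU pfrac_conv //= mxE.
  by rewrite (_ : _ == _ = false) //; apply/eqP; have := ltn_ord i; lia.
have dul : \det (ulsubmx (H *m U)) != 0.
  have -> : ulsubmx (H *m U) = perm_mx (perm (@rev_ord_inj v)).
    apply/matrixP => i j; rewrite 2!mxE HU pfrac_conv //= !mxE permE.
    congr (_%:R); congr nat_of_bool.
    by rewrite -val_eqE /=; have := ltn_ord i; have := ltn_ord j; lia.
  by rewrite det_perm signr_eq0.
pose L : 'M[F]_m := \matrix_(i, t) if (t <= i)%N then u (i - t)%N else 0.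
have dr : drsubmx (H *m U) = b^-1 *: (L *m (\matrix_(p, q) pfrac_next (p + q)%N)).
  apply/matrixP => i j; rewrite 2!mxE HU pfrac_conv_tail !mxE; congr (_ * _).
  rewrite -(big_mkord xpredT (fun t => u (i - t)%N * pfrac_next (t + j)%N)).
  transitivity (\sum_(0 <= t < m) (if (t <= i)%N then u (i - t)%N else 0) * pfrac_next (t + j)%N).
    rewrite [RHS](big_cat_nat (n := i.+1)) //=.
    rewrite [X in _ = _ + X]sum_nat_eq0 ?addr0; last first.
      by move=> t ht; rewrite ifF ?mul0r //; lia.
    by rewrite !big_nat; apply: eq_bigr => t ht; rewrite ifT //; lia.
  by rewrite big_mkord; apply: eq_bigr => t _; rewrite !mxE.
have dL : \det L != 0.
  rewrite det_trig; last first.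
    by apply/is_trig_mxP => i j ltij; rewrite !mxE leqNgt ltij.
  by apply/prodf_neq0 => i _; rewrite !mxE leqnn subnn.
have := det_mulmx H U.
rewrite -[H *m U]submxK ur0 det_lblock dr detZ det_mulmx => E.
have -> : hankel_det c (v + m) = \det H by [].
have := congr1 (fun x => x != 0) E.
rewrite /= !mulf_eq0 !negb_or dU dul dL expf_neq0 ?invr_eq0 //= andbT => <-.
by [].
Qed.

Lemma hankel_det_first : hankel_det c v != 0.
Proof.
by have := hankel_det_step 0; rewrite addn0 => ->; rewrite /hankel_det det_mx00 oner_eq0.
Qed.

(** The coefficient vector of [pfrac_quot], whose last entry is [1], is sent by
the matrix to [pfrac_quot] times the last basis vector. *)
Lemma pfrac_quot_det :
  (hankel_det c v)^-1 *:
  \det (\matrix_(p < v.+1, q < v.+1)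
          if (p < v)%N then (c (p + q)%N)%:P else 'X^q) = pfrac_quot.
Proof.
set A := (\matrix_(_, _) _).
pose w : 'cV[{poly F}]_v.+1 := \col_q (pfrac_quot`_q)%:P.
have wE q : (q < v.+1)%N -> pfrac_quot`_q = b * r (v - q)%N.
  by move=> ltq; rewrite coefZ coef_poly ltq.
have Aw : A *m w = pfrac_quot *: delta_mx ord_max 0.
  apply/matrixP => p j; rewrite !mxE {j}(ord1 j) eqxx andbT.
  have hp := ltn_ord p.
  have [ltpv|levp] := ltnP p v.
    rewrite (_ : p == ord_max = false) ?mulr0; last by rewrite -val_eqE /= ltn_eqF.
    transitivity ((b * \sum_(t < v.+1) c (p + t)%N * r (v - t)%N)%:P).
      rewrite mulr_sumr rmorph_sum; apply: eq_bigr => q _.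
      by rewrite !mxE ltpv wE // -polyCM mulrCA.
    rewrite pfrac_conv // (_ : _ == _ = false) ?mulr0 //.
    by apply/eqP; lia.
  have -> : p = ord_max by apply/val_inj => /=; lia.
  rewrite eqxx mulr1 [RHS](_ : _ = \poly_(i < v.+1) (b * r (v - i)%N)); last first.
    by apply/polyP => i; rewrite coefZ !coef_poly; case: ifP; rewrite ?mulr0.
  rewrite poly_def; apply: eq_bigr => q _.
  by rewrite !mxE /= ltnn wE // mulrC mul_polyC.
have := congr1 (mulmx (\adj A)) Aw.
rewrite mulmxA mul_adj_mx mul_scalar_mx => /matrixP /(_ ord_max 0).
rewrite -scalemxAr !mxE (bigD1 ord_max) //= !mxE !eqxx mulr1.
rewrite big1 ?addr0; last first.
  by move=> q /negbTE qm; rewrite !mxE qm mulr0.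
rewrite wE // subnn r0 divff // mulr1 => ->.
rewrite /cofactor addnn -signr_odd odd_double expr0 mul1r.
have -> : row' ord_max (col' ord_max A) =
          map_mx polyC (\matrix_(p < v, q < v) c (p + q)%N).
  apply/matrixP => i j; rewrite !mxE /=.
  have hi : (i < v)%N := ltn_ord i; have hj : (j < v)%N := ltn_ord j.
  by rewrite /bump (leqNgt v i) (leqNgt v j) hi hj /= !add0n hi.
rewrite det_map_mx -/(hankel_det c v) mulrC mul_polyC scalerA mulVf ?scale1r //.
exact: hankel_det_first.
Qed.

(** [X^K * sum_(i < K) c_i / X^(i+1)]. *)
Definition moment_poly (K : nat) (c : nat -> F) : {poly F} :=
  \poly_(i < K) c (K.-1 - i)%N.

(** The identity [c * (a - c1) = b] for truncated series, multiplied by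
[X^(2 * K)]; the bound on the size expresses that the identity holds up to a
term [O(z^(v - K - 1))]. *)
Lemma size_pfrac_step K : (v <= K)%N ->
  (size (pfrac_quot * 'X^K * moment_poly K c - b *: 'X^(2 * K)
         - moment_poly K c * moment_poly K pfrac_next)%R <= K + v)%N.
Proof.
move=> levK.
have EcK : moment_poly K c = rev_trunc (K - v) u.
  apply/polyP => i; rewrite !coef_poly /u.
  case: ifP => ltiK; case: ifP => lti //; [congr c; lia| |lia].
  by rewrite c_lt //; lia.
have Er : pfrac_quot * 'X^K - moment_poly K pfrac_next = b *: rev_trunc (K + v) r.
  apply/polyP => i; rewrite coefB coefMXn !coefZ !coef_poly /pfrac_next.
  have [ltiK|leKi] := ltnP i K.
    rewrite sub0r mulNr opprK ifT; last by lia.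
    by congr (_ * r _); lia.
  rewrite subr0; have -> : (i < (K + v).+1)%N = (i - K < v.+1)%N by lia.
  by case: ifP => // _; congr (_ * r _); lia.
have -> : pfrac_quot * 'X^K * moment_poly K c - b *: 'X^(2 * K)
         - moment_poly K c * moment_poly K pfrac_next =
   b *: (rev_trunc (K - v) u * rev_trunc (K + v) r - 'X^(2 * K)).
  rewrite scalerBr scalerAr -Er -EcK; ring.
apply: (leq_trans (size_scale_leq _ _)); apply/leq_sizeP => j lej.
rewrite coefB coefXn.
have [ltj|gej] := ltnP (2 * K) j.
  rewrite gtn_eqF // subr0; apply: nth_default.
  apply: (leq_trans (size_polyMleq _ _)).
  have := size_poly (K - v).+1 (fun i => u (K - v - i)%N).
  have := size_poly (K + v).+1 (fun i => r (K + v - i)%N).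
  rewrite /rev_trunc; lia.
have {1}-> : (j = (K - v) + (K + v) - (2 * K - j))%N by lia.
rewrite coef_mul_rev_trunc; [|lia|lia].
rewrite recipP //; have -> : (2 * K - j == 0)%N = (j == 2 * K)%N by apply/eqP/eqP; lia.
by rewrite subrr.
Qed.

End PFractionStep.

(** The first normal index [v] of a sequence is the position, counted from [1],
of its first nonzero term. *)
Lemma first_normal_index (F : fieldType) (c : nat -> F) v : (0 < v)%N ->
  (forall m, (0 < m < v)%N -> hankel_det c m = 0) -> hankel_det c v != 0 ->
  (forall i, (i < v.-1)%N -> c i = 0) /\ c v.-1 != 0.
Proof.
move=> v0 Dlt Dv.
have c_lt i : (i < v.-1)%N -> c i = 0.
  elim/ltn_ind: i => i IH lti; apply/eqP/negPn/negP => ci.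
  have := @hankel_det_first _ c i.+1 isT; rewrite Dlt; last by lia.
  rewrite eqxx => H; have := H _ ci; move/(_ _)/notF; apply.
  by move=> k ltk; apply: IH => //; lia.
split=> //; apply/eqP => cb; case/eqP: Dv.
rewrite /hankel_det; have lt0 : (0 < v)%N by [].
rewrite (expand_det_row _ (Ordinal lt0)) big1 // => q _; rewrite mxE /=.
have := ltn_ord q; case: (ltngtP q v.-1) => [h _|h|-> _]; last by rewrite cb mul0r.
  by rewrite c_lt ?mul0r.
by lia.
Qed.

(** * Orthogonality of the denominators *)

Section Approximants.
Variable F : fieldType.

(** [p * c + q = O(z^(-M-1))], where [c = sum c_i / z^(i+1)]: for all large
truncation orders [K] the polynomial [X^K * (p * c + q)] has size at most
[K - M]. *)
Definition approximant (c : nat -> F) (p q : {poly F}) (M : nat) : Prop :=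
  exists K0, forall K, (K0 <= K)%N ->
    (size (p * moment_poly K c + 'X^K * q)%R <= K - M)%N.

(** An approximant of the tail lifts to one of the whole series, since
[(a * p + q) * c - b * p = c * (c1 * p + q)]. *)
Lemma approximant_step c v p q M : (0 < v)%N ->
  (forall i, (i < v.-1)%N -> c i = 0) -> c v.-1 != 0 ->
  approximant (pfrac_next c v) p q M ->
  approximant c (pfrac_quot c v * p + q) (- c v.-1 *: p) (M + v).
Proof.
move=> v0 c_lt cb [K0 HK].
exists (maxn K0 (size p + 2 * v + M))%N => K; rewrite geq_max => /andP[leK0 leK].
set W := (X in size (polyseq X)).
have [->|W0] := eqVneq W 0; first by rewrite size_poly0.
have EW : 'X^K * W =
  p * (pfrac_quot c v * 'X^K * moment_poly K c - c v.-1 *: 'X^(2 * K)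
         - moment_poly K c * moment_poly K (pfrac_next c v))
  + moment_poly K c * (p * moment_poly K (pfrac_next c v) + 'X^K * q).
  by rewrite /W mul2n -addnn exprD -!mul_polyC !rmorphN /=; ring.
have szc : (size (moment_poly K c) <= (K - v).+1)%N.
  apply/leq_sizeP => j hj; rewrite coef_poly; case: ifP => // ltj.
  by rewrite c_lt //; lia.
have s1 : (size ('X^K * W)%R = K + size W)%N.
  rewrite size_monicM ?monicXn // size_polyXn; lia.
have s2 : (size ('X^K * W)%R <= 2 * K - (M + v))%N.
  rewrite EW; apply: (leq_trans (size_polyD _ _)); rewrite geq_max; apply/andP; split.
    apply: (leq_trans (size_polyMleq _ _)).
    have lev : (v <= K)%N by lia.
    by have := size_pfrac_step v0 c_lt cb lev; lia.
  apply: (leq_trans (size_polyMleq _ _)).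
  by have := HK K leK0; lia.
lia.
Qed.

(** The vanishing of the coefficient of [z^(-i-1)] of [p * c + q], for
[i < M]. *)
Lemma approximant_orthogonal c (p q : {poly F}) M i n : (size p <= n)%N -> (i < M)%N ->
  approximant c p q M -> \sum_(t < n) p`_t * c (t + i)%N = 0.
Proof.
move=> szp ltiM [K0 HK].
pose K := (K0 + M + n + i.+1)%N.
have leK : (K0 <= K)%N by rewrite /K; lia.
have /leq_sizeP/(_ (K.-1 - i)%N) := HK K leK.
rewrite coefD coefXnM ifT; last by rewrite /K; lia.
rewrite addr0 coefM => H.
rewrite -[RHS]H; last by rewrite /K; lia.
rewrite -(big_mkord xpredT (fun t => p`_t * c (t + i)%N)).
rewrite -(big_mkord xpredT (fun t => p`_t * (moment_poly K c)`_(K.-1 - i - t))).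
rewrite [RHS](big_cat_nat (n := n)) //=; last by rewrite /K; lia.
rewrite [X in _ = _ + X]sum_nat_eq0 ?addr0; last first.
  by move=> t /andP[let_ _]; rewrite nth_default ?mul0r // (leq_trans szp).
rewrite !big_nat; apply: eq_bigr => t ht.
rewrite coef_poly ifT; last by rewrite /K; lia.
by congr (_ * c _); rewrite /K; lia.
Qed.

(** If [p = X * w] then [w] is a nonzero vector in the kernel of the shifted
Hankel matrix of order [M]. *)
Lemma approximant_root0 c (p q : {poly F}) M : p != 0 -> (size p <= M.+1)%N -> p.[0] = 0 ->
  approximant c p q M -> \det (\matrix_(s < M, t < M) c (s + t).+1%N) = 0.
Proof.
move=> p0 szp p00 Hp; set A := (\matrix_(_, _) _).
pose w : 'cV[F]_M := \col_t p`_t.+1.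
have Aw : A *m w = 0.
  apply/matrixP => s j; rewrite !mxE.
  have := approximant_orthogonal szp (ltn_ord s) Hp.
  rewrite big_ord_recl -horner_coef0 p00 mul0r add0r => E.
  rewrite -[RHS]E; apply: eq_bigr => t _.
  by rewrite !mxE mulrC /= /bump /=; congr (_ * c _); lia.
have := congr1 (mulmx (\adj A)) Aw.
rewrite mulmxA mul_adj_mx mul_scalar_mx mulmx0 => /matrixP H.
apply/eqP/negPn/negP => dA; case/eqP: p0; apply/polyP => -[|t].
  by rewrite -horner_coef0 p00 coef0.
rewrite coef0; have [ltt|let_] := ltnP t M; last first.
  by apply: nth_default; apply: leq_trans szp _.
have := H (Ordinal ltt) 0; rewrite !mxE => /eqP.
by rewrite mulf_eq0 (negbTE dA) => /eqP.
Qed.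

(** The pair [(P_k, P_(k-1))], where [P_(k+1) = a_k P_k - b_k P_(k-1)],
[P_0 = 1] and [P_(-1) = 0]. *)
Fixpoint continuant (a b : nat -> F) (k : nat) : F * F :=
  if k is k'.+1 then
    let: (x, y) := continuant a b k' in (a k' * x - b k' * y, x)
  else (1, 0).

(** The value at [0] of the denominator [P_j] of a P-fraction with atoms
[a_k, b_k] is nonzero if the shifted Hankel determinant of order
[v_0 + ... + v_j - 1] is. The denominator is built from the inside, starting
with the approximant [(1, 0)] of the [j]-th tail; the scalar product of
[(P_k(0), P_(k-1)(0))] with the values at [0] of the approximant of the [k]-th
tail does not depend on [k]. *)
Lemma continuant_neq0 (c : nat -> nat -> F) (v : nat -> nat) (j : nat) :
  (forall k, (k <= j)%N -> [/\ (0 < v k)%N,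
     forall i, (i < (v k).-1)%N -> c k i = 0 & c k (v k).-1 != 0]) ->
  (forall k, (k < j)%N -> c k.+1 =1 pfrac_next (c k) (v k)) ->
  \det (\matrix_(s < (\sum_(i < j.+1) v i).-1, t < (\sum_(i < j.+1) v i).-1)
     c 0%N (s + t).+1%N) != 0 ->
  (continuant (fun k => (pfrac_quot (c k) (v k)).[0])
              (fun k => c k (v k).-1) j).1 != 0.
Proof.
move=> Hc Hnext; set a := (fun k => _.[0]); set b := (fun k => c k _).
have main i k : (k + i = j)%N -> exists p q : {poly F},
    [/\ approximant (c k) p q (\sum_(k <= l < j.+1) v l).-1,
        size p = (\sum_(k <= l < j) v l).+1,
        (size q < size p)%N &
        (continuant a b k).1 * p.[0] + (continuant a b k).2 * q.[0] =
        (continuant a b j).1].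
  elim: i k => [|i IH] k kij.
    move: kij; rewrite addn0 => ->; exists 1, 0.
    have [v0 c_lt cb] := Hc j (leqnn j).
    split; last by rewrite horner0 mulr0 addr0 hornerE mulr1.
    - rewrite big_nat1; exists (v j) => K leK.
      rewrite mulr0 addr0 mul1r; apply/leq_sizeP => l hl; rewrite coef_poly.
      by case: ifP => // ltl; rewrite c_lt //; lia.
    - by rewrite size_poly1 big_geq.
    - by rewrite size_poly0 size_poly1.
  have ltkj : (k < j)%N by lia.
  have [|p [q [Hp szp szq val]]] := IH k.+1; first by lia.
  have [v0 c_lt cb] := Hc k (ltnW ltkj).
  have [v0' _ _] := Hc j (leqnn j).
  exists (pfrac_quot (c k) (v k) * p + q), (- c k (v k).-1 *: p).
  have sza : size (pfrac_quot (c k) (v k)) = (v k).+1.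
    rewrite size_scale // /rev_trunc size_poly_eq // subnn recip0 ?addn0 //.
    by rewrite invr_eq0.
  have p0 : p != 0 by rewrite -size_poly_eq0 szp.
  have a0 : pfrac_quot (c k) (v k) != 0 by rewrite -size_poly_eq0 sza.
  have szap : (size (pfrac_quot (c k) (v k) * p)%R = v k + size p)%N.
    by rewrite size_mul // sza.
  have szD : (size (pfrac_quot (c k) (v k) * p + q)%R = v k + size p)%N.
    by rewrite size_polyDl szap //; lia.
  split.
  - rewrite big_ltn; last by lia.
    have -> : (v k + \sum_(k.+1 <= l < j.+1) v l).-1 =
              ((\sum_(k.+1 <= l < j.+1) v l).-1 + v k)%N.
      by rewrite big_nat_recr //=; lia.
    apply: approximant_step => //.
    case: Hp => K0 HK; exists K0 => K leK.
    have <- : moment_poly K (c k.+1) = moment_poly K (pfrac_next (c k) (v k)).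
      by apply: eq_poly => l _; rewrite Hnext.
    exact: HK.
  - by rewrite szD szp [in RHS]big_ltn // addnS.
  - by rewrite szD size_scale ?oppr_eq0 // -[X in (X < _)%N]add0n ltn_add2r v0.
  - rewrite -val /=; case: (continuant a b k) => x y /=.
    by rewrite hornerD hornerM [(_ *: p).[0]]hornerZ /a /b; ring.
move=> Hdet; have [p [q [Hp szp szq]]] := main j 0%N (erefl _).
rewrite /= mul1r mul0r addr0 => <-.
apply: contra Hdet => /eqP p00; apply/eqP.
have [v0' _ _] := Hc j (leqnn j).
rewrite big_mkord in Hp; apply: approximant_root0 p00 Hp.
  by rewrite -size_poly_eq0 szp.
by rewrite szp big_mkord big_ord_recr /=; lia.
Qed.

End Approximants.

(** * Normal indices and derived sequences *)

Section NormalIndices.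
Variables (R : realType) (nn : nat) (c : nat -> R) (e : R).
Hypothesis nn_normal : is_normal_index nn c nn.

Local Notation N := (num_normal nn c).
Local Notation ni := (normal_index nn c).
Local Notation nu := (nu nn c).
Local Notation cc := (derived_seq nn c).

Lemma nn_gt0 : (0 < nn)%N. Proof. by case/andP: nn_normal => /andP[]. Qed.

Lemma normal_index_last : ni N = nn.
Proof.
rewrite /normal_index /num_normal nth_last /= /normal_indices.
have := nn_normal; case: nn => [|m] Hm; first by [].
by rewrite -addn1 iotaD filter_cat last_cat /= add1n addn1 Hm.
Qed.

Lemma num_normal_gt0 : (0 < N)%N.
Proof.
case: (posnP N) => // N0; have := normal_index_last; rewrite N0 /normal_index /= => h.
by have := nn_gt0; rewrite -h.
Qed.

Lemma sorted_normal_indices : sorted ltn (0%N :: normal_indices nn c).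
Proof.
rewrite /= path_sortedE; last exact: ltn_trans.
apply/andP; split; last by apply: sorted_filter; [exact: ltn_trans|exact: iota_ltn_sorted].
by apply/allP => m; rewrite mem_filter mem_iota => /andP[_ /andP[]].
Qed.

Lemma normal_index_lt i j : (i < j)%N -> (j <= N)%N -> (ni i < ni j)%N.
Proof.
move=> ltij lejN; rewrite /normal_index.
have lti : (i <= N)%N by apply: leq_trans lejN; apply: ltnW.
by apply: (sorted_ltn_nth ltn_trans _ sorted_normal_indices).
Qed.

Lemma normal_index_hankel k : (k < N)%N -> hankel c (ni k.+1) != 0.
Proof.
move=> ltkN; have : ni k.+1 \in normal_indices nn c by apply: mem_nth.
by rewrite mem_filter => /andP[/andP[]].
Qed.

Lemma normal_index_le k : (k <= N)%N -> (ni k <= nn)%N.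
Proof.
rewrite leq_eqVlt => /orP[/eqP->|ltk]; first by rewrite normal_index_last.
by rewrite -[X in (_ <= X)%N]normal_index_last ltnW // normal_index_lt.
Qed.

Lemma hankel_gap k m : (k < N)%N -> (ni k < m < ni k.+1)%N -> hankel c m = 0.
Proof.
move=> ltkN /andP[ltm gtm]; apply/eqP/negPn/negP => Dm.
have : m \in normal_indices nn c.
  rewrite mem_filter mem_iota /is_normal_index Dm andbT.
  by have := normal_index_le ltkN; lia.
move/(nthP 0%N) => [i ltiN Ei].
have Em : m = ni i.+1 by rewrite -Ei.
have [lti|gti|Ek] := ltngtP i k.
- have : (i.+1 <= k)%N by [].
  rewrite leq_eqVlt => /orP[/eqP E|h]; first by rewrite Em E ltnn in ltm.
  by have := normal_index_lt h (ltnW ltkN); lia.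
- by have := @normal_index_lt k.+1 i.+1 gti ltiN; lia.
- by move: gtm; rewrite Em Ek ltnn.
Qed.

Lemma nu_gt0 k : (k < N)%N -> (0 < nu k.+1)%N.
Proof. by move=> ltkN; rewrite /Defs.nu subn_gt0 normal_index_lt. Qed.

Lemma normal_indexS k : (k < N)%N -> ni k.+1 = (ni k + nu k.+1)%N.
Proof. by move=> ltkN; rewrite /Defs.nu subnKC // ltnW // normal_index_lt. Qed.

Lemma sum_nu k : (k <= N)%N -> (\sum_(i < k) nu i.+1 = ni k)%N.
Proof.
elim: k => [|k IH] lek; first by rewrite big_ord0.
by rewrite big_ord_recr /= IH ?normal_indexS //; apply: ltnW.
Qed.

Lemma derived_seqS k : (0 < nu k.+1)%N ->
  (forall i, (i < (nu k.+1).-1)%N -> cc k i = 0) -> cc k (nu k.+1).-1 != 0 ->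
  cc k.+1 =1 pfrac_next (cc k) (nu k.+1).
Proof. by move=> v0 c_lt cb i; rewrite -pfrac_next_det. Qed.

(** The normal indices of the [k]-th derived sequence are the [n_j - n_k] with
[j > k]; therefore its first nonzero term has index [nu_(k+1) - 1]. *)
Lemma hankel_derived k : (k < N)%N ->
  (forall m, (hankel c (ni k + m) != 0) = (hankel (cc k) m != 0)) /\
  ((forall i, (i < (nu k.+1).-1)%N -> cc k i = 0) /\ cc k (nu k.+1).-1 != 0).
Proof.
elim: k => [|k IH] ltkN.
  split=> [m|]; first by rewrite add0n.
  apply: first_normal_index; first exact: nu_gt0.
    move=> m hm; apply: (@hankel_gap 0) => //.
    by rewrite normal_indexS.
  by have := normal_index_hankel ltkN; rewrite normal_indexS.
have [H [c_lt cb]] := IH (ltnW ltkN).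
have v0 := nu_gt0 (ltnW ltkN).
have HS m : (hankel c (ni k.+1 + m) != 0) = (hankel (cc k.+1) m != 0).
  rewrite normal_indexS ?(ltnW ltkN) // -addnA H.
  rewrite [LHS](hankel_det_step v0 c_lt cb); congr (_ != 0).
  by congr (\det _); apply/matrixP => p q; rewrite !mxE derived_seqS.
split=> //.
apply: first_normal_index; first exact: nu_gt0.
  move=> m hm; apply/eqP; rewrite -[_ == 0]negbK -[_ != 0]HS negbK; apply/eqP.
  by apply: (@hankel_gap k.+1) => //; rewrite (normal_indexS ltkN); lia.
by rewrite -[_ != 0]HS -normal_indexS // normal_index_hankel.
Qed.

Lemma derived_seq_lt k i : (k < N)%N -> (i < (nu k.+1).-1)%N -> cc k i = 0.
Proof. by move=> ltkN; have [_ [h _]] := hankel_derived ltkN; exact: h. Qed.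

Lemma patom_b_neq0 k : (k < N)%N -> patom_b nn c k != 0.
Proof. by move=> ltkN; have [_ [_ h]] := hankel_derived ltkN. Qed.

Local Notation ce := (derived_seq_ext nn c e).

Lemma derived_seq_extE k i : (k.+1 < N)%N -> ce k i = cc k i.
Proof. by move=> ltkN; rewrite /derived_seq_ext ltn_eqF. Qed.

(** The arbitrary value [e] sits at index [2 nu_N - 1] of the last sequence,
beyond everything that determines its Hankel determinant of order [nu_N]. *)
Lemma derived_seq_ext_low k i : (k < N)%N -> (i < (nu k.+1).*2.-1)%N -> ce k i = cc k i.
Proof.
move=> ltkN lti; rewrite /derived_seq_ext; case: eqP => //= EN.
by rewrite -EN ltn_eqF.
Qed.

Lemma derived_seq_ext_lt k i : (k < N)%N -> (i < (nu k.+1).-1)%N -> ce k i = 0.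
Proof.
move=> ltkN lti; rewrite derived_seq_ext_low ?derived_seq_lt //; lia.
Qed.

Lemma derived_seq_ext_b k : (k < N)%N -> ce k (nu k.+1).-1 = patom_b nn c k.
Proof. by move=> ltkN; rewrite derived_seq_ext_low //; have := nu_gt0 ltkN; lia. Qed.

Lemma patom_aE k : (k < N)%N -> patom_a nn c e k = pfrac_quot (ce k) (nu k.+1).
Proof.
move=> ltkN; rewrite -pfrac_quot_det ?nu_gt0 ?derived_seq_ext_b ?patom_b_neq0 //; last first.
  by move=> i; apply: derived_seq_ext_lt.
congr (_^-1 *: _); congr (\det _); apply/matrixP => p q; rewrite !mxE.
by rewrite derived_seq_ext_low //; have := ltn_ord p; have := ltn_ord q; lia.
Qed.

(** The values at [0] of the denominators [P_k] and [P_(k-1)] of the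
P-fraction. *)
Definition satom_continuant (k : nat) : R * R :=
  continuant (fun k => (patom_a nn c e k).[0]) (patom_b nn c) k.

(** Only the atoms [a_k] with [k < N - 1] enter, and these do not depend on
[e]. *)
Lemma satom_continuant_neq0 : regular nn c -> forall k, (k < N)%N -> (satom_continuant k).1 != 0.
Proof.
move=> Hreg j ltjN.
have E k : (k <= j)%N -> satom_continuant k =
    continuant (fun k => (pfrac_quot (cc k) (nu k.+1)).[0])
               (fun k => cc k (nu k.+1).-1) k.
  elim: k => //= k IH ltkj; rewrite /satom_continuant /= -/(satom_continuant k) IH; last exact: ltnW.
  case: (continuant _ _ _) => x y; rewrite patom_aE; last by lia.
  congr ((_ - _, _)); congr (_.[0] * _); apply/polyP => i.
  rewrite /pfrac_quot !coefZ; congr (_ * _); first by rewrite derived_seq_extE //; lia.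
  congr (_`_i); congr rev_trunc; congr recip; apply/funext => l.
  by rewrite derived_seq_extE //; lia.
rewrite E //; apply: (@continuant_neq0 _ cc (fun k => nu k.+1)).
- move=> k lekj; have ltkN : (k < N)%N by lia.
  by split; [exact: nu_gt0|move=> i; exact: derived_seq_lt|exact: patom_b_neq0].
- move=> k ltkj i; have ltkN : (k < N)%N by lia.
  apply: derived_seqS; first exact: nu_gt0.
    by move=> l; apply: derived_seq_lt.
  exact: patom_b_neq0.
- by rewrite sum_nu //; exact: Hreg.
Qed.

(** The formula [1 / l_j = - d_j P_j(0) / P_(j-1)(0)]. *)
Lemma satomE : regular nn c -> forall j, (j < N)%N ->
  satom_d nn c e j.+1 != 0 /\
  ((j.+1 < N)%N -> satom_l nn c e j.+1 != 0 /\
    (satom_l nn c e j.+1)^-1 =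
      - (satom_d nn c e j.+1 * (satom_continuant j.+1).1 / (satom_continuant j).1)).
Proof.
move=> Hreg; have X := satom_continuant_neq0 Hreg.
elim=> [|j IH] ltjN.
  have b0 := patom_b_neq0 ltjN.
  rewrite /satom_d /satom_l /=; split; first by rewrite div1r invr_eq0.
  move=> lt1N; have := X _ lt1N.
  rewrite /satom_continuant /= mulr1 mulr0 subr0 => a0; split.
    by rewrite oppr_eq0 div1r invr_eq0 mulf_neq0 // div1r invr_eq0.
  by rewrite !div1r invrN invrK divr1.
have [d0 /(_ ltjN) [l0 El]] := IH (ltnW ltjN).
have b0 := patom_b_neq0 ltjN.
rewrite /satom_d /satom_l /= -/(satom_d nn c e j.+1).
move: d0 l0 El; rewrite /satom_d /satom_l /=.
case: (satom_dl nn c e j) => d l /= d0 l0 El.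
have x0 := X _ (ltnW ltjN); have x1 := X _ ltjN.
split; first by rewrite div1r invr_eq0; do 2?[apply: mulf_neq0 => //]; apply: expf_neq0.
move=> lt2N; have := X _ lt2N.
have C2 : (satom_continuant j.+2).1 = (patom_a nn c e j.+1).[0] * (satom_continuant j.+1).1
   - patom_b nn c j.+1 * (satom_continuant j).1.
  by rewrite /satom_continuant /=; case: (continuant _ _ j).
rewrite {}C2.
move: (satom_continuant j).1 (satom_continuant j.+1).1 x0 x1 El (patom_b nn c j.+1) b0
  (patom_a nn c e j.+1).[0] => x y x0 y0 El b b0 a z0.
have {El}-> : l = - (x / (d * y)).
  by rewrite -[LHS]invrK El invrN !invf_div.
set D := 1 + _.
have DE : D = (a * y - b * x) / (- (b * x)).
  by rewrite /D; field; rewrite d0 b0 x0 y0.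
have D0 : D != 0.
  by rewrite DE mulf_neq0 // invr_eq0 oppr_eq0 mulf_neq0.
split.
  rewrite oppr_eq0; apply: mulf_neq0; last by rewrite invr_eq0.
  by rewrite oppr_eq0; apply: mulf_neq0 => //; rewrite invr_eq0; apply: mulf_neq0.
rewrite DE; field; rewrite d0 b0 x0 y0 z0 //=.
Qed.

End NormalIndices.

(** * Asymptotic expansions at infinity *)

(** The filter [F] is any filter along which [z] tends to infinity. It is not
required to be proper. *)
Section AtInfinity.
Variables (K : numFieldType) (F : set_system K).
Context {FF : Filter F}.
Hypothesis znz : \forall z \near F, z != 0.

(** Convergence of a function on the field along [F]. *)
Definition tends (f : K -> K) (l : K) : Prop := f @ F --> l.

Hypothesis zinf : tends (fun z => z^-1) 0.

Lemma tendsD f g l m : tends f l -> tends g m -> tends (fun z => f z + g z) (l + m).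
Proof. exact: cvgD. Qed.

Lemma tendsB f g l m : tends f l -> tends g m -> tends (fun z => f z - g z) (l - m).
Proof. exact: cvgB. Qed.

Lemma tendsM f g l m : tends f l -> tends g m -> tends (fun z => f z * g z) (l * m).
Proof. exact: cvgM. Qed.

Lemma tendsV f l : l != 0 -> tends f l -> tends (fun z => (f z)^-1) l^-1.
Proof. exact: cvgV. Qed.

Lemma tends_cst l : tends (fun=> l) l.
Proof. exact: cvg_cst. Qed.

Lemma tends_neq0 f l : tends f l -> l != 0 -> \forall z \near F, f z != 0.
Proof. exact: cvgr_neq0. Qed.

(** Far out one may assume [z <> 0]. *)
Lemma tends_near_eq (f g : K -> K) (l : K) : tends f l ->
  (\forall z \near F, z != 0 -> f z = g z) -> tends g l.
Proof.
move=> fl fg; apply: cvg_trans fl; apply: near_eq_cvg.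
by near=> z; apply: (near fg z) => //; near: z.
Unshelve. all: by end_near. Qed.

Lemma tends_exprVn n : tends (fun z => z ^- n.+1) 0.
Proof.
elim: n => [|n IH].
  by apply: (tends_near_eq zinf _); near=> z => _; rewrite expr1.
have := tendsM zinf IH; rewrite mul0r; move/tends_near_eq; apply.
by near=> z => _; rewrite [in RHS]exprS invfM.
Unshelve. all: by end_near. Qed.

Lemma tends_poly_lead (p : {poly K}) n : (size p <= n.+1)%N ->
  tends (fun z => p.[z] / z ^+ n) p`_n.
Proof.
elim: n p => [|n IH] p szp.
  rewrite [p]size1_polyC // coefC /=.
  have /tends_near_eq := @tends_cst p`_0; apply.
  by near=> z => _; rewrite hornerC expr0 divr1.
pose q : {poly K} := \poly_(i < n.+1) p`_i.+1.
have Ep : p = q * 'X + (p`_0)%:P.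
  apply/polyP => -[|i]; rewrite coefD coefMX coefC /= ?add0r // addr0 coef_poly.
  case: ltnP => // lei; rewrite nth_default //; exact: leq_trans szp _.
have szq : (size q <= n.+1)%N by exact: size_poly.
have := tendsD (IH q szq) (tendsM (@tends_cst p`_0) (tends_exprVn n)).
rewrite mulr0 addr0 coef_poly ltnSn; move/tends_near_eq; apply.
near=> z => z0 /=.
rewrite [in RHS]Ep hornerD hornerMX hornerC mulrDl; congr (_ + _).
by rewrite exprSr invfM mulrACA divff // mulr1.
Unshelve. all: by end_near. Qed.

Lemma tends_poly0 (p : {poly K}) n : (size p <= n)%N ->
  tends (fun z => p.[z] / z ^+ n) 0.
Proof.
move=> szp; rewrite -[X in tends _ X](nth_default 0 szp); apply: tends_poly_lead.
exact: leqW.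
Qed.

(** [f = - p / z^M + o(z^(-M))]. With [p = moment_poly M c] this is the
expansion [f = - sum_(i < M) c_i / z^(i+1) + o(z^(-M))]. *)
Definition has_expansion (f : K -> K) (M : nat) (p : {poly K}) : Prop :=
  tends (fun z => z ^+ M * f z + p.[z]) 0.

Lemma has_expansion_tends0 f M (p : {poly K}) : (size p <= M)%N -> has_expansion f M p ->
  tends f 0.
Proof.
move=> szp H.
have : tends (fun z => z ^- M * (z ^+ M * f z + p.[z]) - p.[z] / z ^+ M) 0.
  rewrite -[X in tends _ X]subr0; apply: tendsB; last exact: tends_poly0.
  case: M szp H => [|M] szp H.
    by apply: (tends_near_eq H _); near=> z => _; rewrite expr0 invr1 !mul1r.
  by rewrite -[X in tends _ X](mul0r 0); apply: tendsM H; apply: tends_exprVn.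
move/tends_near_eq; apply; near=> z => z0; have zM : z ^+ M != 0 by rewrite expf_neq0.
by rewrite mulrDr mulKf // [X in _ + X - _]mulrC addrK.
Unshelve. all: by end_near. Qed.

Lemma has_expansion_lead f M (p : {poly K}) v : (v <= M)%N -> (size p <= (M - v).+1)%N ->
  has_expansion f M p -> tends (fun z => z ^+ v * f z) (- p`_(M - v)).
Proof.
move=> levM szp H.
have : tends (fun z => (z ^+ M * f z + p.[z]) / z ^+ (M - v) - p.[z] / z ^+ (M - v))
    (- p`_(M - v)).
  rewrite -[X in tends _ X]sub0r; apply: tendsB; last exact: tends_poly_lead.
  case: (M - v)%N => [|k].
    by apply: (tends_near_eq H _); near=> z => _; rewrite expr0 divr1.
  by rewrite -[X in tends _ X](mul0r 0); apply: tendsM H _; apply: tends_exprVn.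
move/tends_near_eq; apply; near=> z => z0.
have zv : z ^+ (M - v) != 0 by rewrite expf_neq0.
have -> : z ^+ M = z ^+ (M - v) * z ^+ v by rewrite -exprD subnK.
by move: (z ^+ (M - v)) (z ^+ v) zv => Z V Z0; field.
Unshelve. all: by end_near. Qed.

Lemma has_expansion_neq0 f M (p : {poly K}) v : (v <= M)%N -> (size p <= (M - v).+1)%N ->
  p`_(M - v) != 0 -> has_expansion f M p -> \forall z \near F, f z != 0.
Proof.
move=> levM szp p0 H; have := has_expansion_lead levM szp H.
rewrite /tends => /cvgr_neq0; rewrite oppr_eq0 => /(_ p0); apply: filterS => z.
by apply: contraNneq => ->; rewrite mulr0.
Qed.

(** If [f = - p / z^M + o(z^(-M))] and [g] is given by [f = - b / (a + g)],
then [g = - p1 / z^M + o(z^(2v - M))], where the polynomial [p1] satisfies the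
formal identity [(p / z^M) * (a - p1 / z^M) = b] up to [O(z^(v - M - 1))]. *)
Lemma expansion_step f M v (a p p1 : {poly K}) b : (v <= M)%N ->
  (size p <= (M - v).+1)%N -> p`_(M - v) = b -> b != 0 ->
  (size a <= v.+1)%N -> (size p1 <= M)%N ->
  (size (a * 'X^M * p - b *: 'X^(2 * M) - p * p1)%R <= M + v)%N ->
  has_expansion f M p ->
  tends (fun z => z ^+ M / z ^+ (2 * v) *
    (- b / f z - a.[z] + p1.[z] / z ^+ M)) 0.
Proof.
move=> levM szp pb b0 sza szp1; set E := (a * _ * _ - _ - _) => szE H.
have fn0 : \forall z \near F, f z != 0.
  by apply: (has_expansion_neq0 levM szp) H; rewrite pb.
have L1 := has_expansion_lead levM szp H; rewrite pb in L1.
have Nb0 : - b != 0 by rewrite oppr_eq0.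
have LE := tends_poly0 szE.
have sza1 : (size (a * 'X^M - p1)%R <= (M + v).+1)%N.
  apply: leq_trans (size_polyD _ _) _; rewrite geq_max size_polyN; apply/andP; split.
    apply: leq_trans (size_polyMleq _ _) _; rewrite size_polyXn.
    by move: sza; clear; lia.
  by apply: leq_trans szp1 _; rewrite -addnS leq_addr.
have LA := tends_poly_lead sza1.
have := tendsM (tendsV Nb0 L1) (tendsB LE (tendsM H LA)).
rewrite mul0r subr0 mulr0; move/tends_near_eq; apply.
near=> z => z0; rewrite /=.
have f0 : f z != 0 by near: z.
have EE : E.[z] = a.[z] * z ^+ M * p.[z] - b * z ^+ (2 * M) - p.[z] * p1.[z].
  by rewrite /E !(hornerD, hornerN, hornerM, hornerZ, hornerXn).
rewrite EE hornerD hornerN hornerM hornerXn.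
rewrite mul2n -addnn mul2n -addnn !exprD.
have zM : z ^+ M != 0 by rewrite expf_neq0.
have zv : z ^+ v != 0 by rewrite expf_neq0.
move: (z ^+ M) (z ^+ v) zM zv => Z V Z0 V0.
by field; rewrite Z0 V0 f0.
Unshelve. all: by end_near. Qed.

(** At the last step [M = 2v - 1], and only [g = o(z)] remains. *)
Lemma expansion_step_last g v (p1 : {poly K}) : (0 < v)%N -> (size p1 <= (2 * v).-1)%N ->
  tends (fun z => z ^+ (2 * v).-1 / z ^+ (2 * v) *
    (g z + p1.[z] / z ^+ (2 * v).-1)) 0 ->
  tends (fun z => g z / z) 0.
Proof.
move=> v0 szp1 H.
have L : tends (fun z => p1.[z] / z ^+ (2 * v)) 0.
  by apply: tends_poly0; apply: leq_trans szp1 _; apply: leq_pred.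
have := tendsB H L; rewrite subr0; move/tends_near_eq; apply; near=> z => z0 /=.
have -> : (2 * v = (2 * v).-1.+1)%N by rewrite prednK // muln_gt0.
rewrite [(_.+1).-1]/= exprS; have : z ^+ (2 * v).-1 != 0 by rewrite expf_neq0.
by move: (z ^+ _) => Z Z0; field; rewrite z0 Z0.
Unshelve. all: by end_near. Qed.

(** At the other steps the expansion of [g] is shortened by [2v] terms. *)
Lemma expansion_step_next g v M (p1 p2 q : {poly K}) :
  p1 = 'X^(2 * v) * p2 + q -> (size q <= 2 * v)%N ->
  tends (fun z => z ^+ (M + 2 * v) / z ^+ (2 * v) *
    (g z + p1.[z] / z ^+ (M + 2 * v))) 0 ->
  has_expansion g M p2.
Proof.
move=> -> szq H.
have := tendsB H (tends_poly0 szq); rewrite subr0; move/tends_near_eq; apply; near=> z => z0 /=.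
rewrite hornerD hornerM hornerXn exprD.
have : z ^+ (2 * v) != 0 by rewrite expf_neq0.
have : z ^+ M != 0 by rewrite expf_neq0.
by move: (z ^+ M) (z ^+ (2 * v)) => Z V Z0 V0; field; rewrite V0 Z0.
Unshelve. all: by end_near. Qed.

End AtInfinity.

(** * The continued fraction at a fixed point *)

Section ContinuedFraction.
Variables (R : realType) (nn : nat) (c : nat -> R) (e : R).
Hypothesis nn_normal : is_normal_index nn c nn.
Hypothesis Hreg : regular nn c.

Local Notation N := (num_normal nn c).
Local Notation C := R[i].
Local Notation a := (patom_a nn c e).
Local Notation b := (patom_b nn c).
Local Notation d := (satom_d nn c e).
Local Notation l := (satom_l nn c e).
Local Notation m := (satom_m nn c e).

Lemma satom_mE j : m j.+1 * 'X = d j.+1 *: (a j - ((a j).[0])%:P).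
Proof.
rewrite /satom_m divpK //= -['X]subr0 -polyC0 dvdp_XsubCl /root hornerZ.
by rewrite hornerD hornerN hornerC subrr mulr0.
Qed.

Lemma ceval_satom_m j z :
  z * ceval (m j.+1) z = (d j.+1)%:C * (ceval (a j) z - ((a j).[0])%:C).
Proof.
have := congr1 (fun p => ceval p z) (satom_mE j).
rewrite /ceval rmorphM /= map_polyX hornerMX mulrC => ->.
by rewrite map_polyZ rmorphB /= map_polyC /= hornerZ hornerD hornerN hornerC.
Qed.

(** [1 / l_j], with the convention [1 / l_0 = 0]. *)
Definition satom_linv (j : nat) : R := if j is 0%N then 0 else (l j)^-1.

Lemma satom_linvS j : (j.+1 < N)%N ->
  satom_linv j.+1 = - (satom_linv j + d j.+1 * (a j).[0]).
Proof.
move=> ltjN; rewrite /satom_linv.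
case: j ltjN => [|j] ltjN.
  by rewrite add0r /satom_l /= div1r invrN invrK.
have [d0 /(_ (ltnW ltjN)) [l0 _]] := satomE e nn_normal Hreg (ltnW (ltnW ltjN)).
have [_ /(_ ltjN) [l1 _]] := satomE e nn_normal Hreg (ltnW ltjN).
have -> : l j.+2 = - (l j.+1 / (1 + l j.+1 * d j.+2 * (a j.+1).[0])).
  by rewrite /satom_l /satom_d /=; case: (satom_dl _ _ _ j).
by rewrite invrN invf_div mulrDl div1r -mulrA [l j.+1 * _]mulrC mulfK.
Qed.

Lemma satom_dS j : (j.+1 < N)%N ->
  d j.+2 * b j.+1 = satom_linv j.+1 ^+ 2 / d j.+1.
Proof.
move=> ltjN; have b0 := patom_b_neq0 nn_normal ltjN.
have [d0 /(_ ltjN) [l0 _]] := satomE e nn_normal Hreg (ltnW ltjN).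
have -> : d j.+2 = 1 / (b j.+1 * l j.+1 ^+ 2 * d j.+1).
  by rewrite /satom_l /satom_d /=; case: (satom_dl _ _ _ j).
by rewrite /satom_linv; field; rewrite b0 l0 d0.
Qed.

Variables (z : C) (t : option C) (f : nat -> C).
Hypothesis fS : forall k, (k < N)%N -> f k.+1 = - (b k)%:C / f k - ceval (a k) z.
Hypothesis f_neq0 : forall k, (k < N)%N -> f k != 0.
Hypothesis lf_neq0 : forall k, (k.+1 < N)%N ->
  (satom_linv k.+1)%:C - (d k.+1)%:C * f k.+1 != 0.
Hypothesis tE : param_inv t = - (satom_linv N.-1)%:C
  - (d N)%:C * ((a N.-1).[0])%:C - (d N)%:C * f N.

(** The [j + 1]-st denominator of the continued fraction. The second part
records the inner denominators, which are nonzero; there [r' = r - 1] is the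
remaining depth. *)
Lemma cfrac_denE r j : (r + j.+1 = N)%N ->
  cfrac_den nn c e z t r j.+1 =
    - (satom_linv j)%:C - (d j.+1)%:C * (ceval (a j) z + f j.+1) /\
  (forall r', r = r'.+1 ->
    cfrac_den nn c e z t r' j.+2 != 0 /\
    (l j.+1)%:C + 1 / cfrac_den nn c e z t r' j.+2 =
      ((satom_linv j.+1)%:C - (d j.+1)%:C * f j.+1)^-1).
Proof.
elim: r j => [|r IH] j rj.
  split=> //=; rewrite tE -rj /= mulNr ceval_satom_m; ring.
have lt2 : (j.+1 < N)%N by lia.
have [E _] := IH j.+1 ltac:(lia).
have f1 := f_neq0 lt2.
have [d0 /(_ lt2) [l0 _]] := satomE e nn_normal Hreg (ltnW lt2).
have dC : (d j.+1)%:C != 0 by rewrite fmorph_eq0.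
have lC : (l j.+1)%:C != 0 by rewrite fmorph_eq0.
have LE : (satom_linv j.+1)%:C = ((l j.+1)%:C)^-1 by rewrite /satom_linv fmorphV.
have lf := lf_neq0 lt2.
have dS : (d j.+2)%:C * (b j.+1)%:C = ((l j.+1)%:C)^-2 / (d j.+1)%:C.
  by rewrite -rmorphM /= satom_dS // /satom_linv rmorphM fmorphV rmorphXn fmorphV /= exprVn.
have E' : cfrac_den nn c e z t r j.+2 =
    (((l j.+1)%:C)^-1 - (d j.+1)%:C * f j.+1) / ((l j.+1)%:C * (d j.+1)%:C * f j.+1).
  rewrite E (fS lt2) LE.
  transitivity (- ((l j.+1)%:C)^-1 + (d j.+2)%:C * (b j.+1)%:C / f j.+1); first by ring.
  rewrite dS; move: (l j.+1)%:C (d j.+1)%:C (f j.+1) lC dC f1 => x y w x0 y0 w0.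
  by field; rewrite x0 y0 w0.
have den0 : cfrac_den nn c e z t r j.+2 != 0.
  rewrite E' mulf_neq0 -?LE // invr_eq0; apply: mulf_neq0 => //; exact: mulf_neq0.
have u : (l j.+1)%:C + 1 / cfrac_den nn c e z t r j.+2 =
      ((satom_linv j.+1)%:C - (d j.+1)%:C * f j.+1)^-1.
  rewrite E' LE; rewrite LE in lf.
  have lf' : 1 + - ((d j.+1)%:C * f j.+1) * (l j.+1)%:C != 0.
    by have := mulf_neq0 lf lC; rewrite mulrDl mulVf.
  move: (l j.+1)%:C (d j.+1)%:C (f j.+1) lC dC f1 lf' => x y w x0 y0 w0 h.
  by field; rewrite x0 h w0 y0.
split; last by move=> r' [<-].
have -> : cfrac_den nn c e z t r.+1 j.+1 = - z * ceval (m j.+1) z +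
    1 / ((l j.+1)%:C + 1 / cfrac_den nn c e z t r j.+2) by [].
rewrite u div1r invrK mulNr ceval_satom_m.
rewrite satom_linvS // rmorphN rmorphD rmorphM /=; ring.
Qed.

Lemma cfrac_den1 : cfrac_den nn c e z t N.-1 1 = (f 0%N)^-1.
Proof.
have N0 := num_normal_gt0 nn_normal.
have [-> _] := @cfrac_denE N.-1 0 ltac:(lia).
rewrite fS //= oppr0 add0r addrC subrK mulNr mulrN opprK mulrA -rmorphM /=.
by rewrite /satom_d /= div1r mulVf ?patom_b_neq0 // mul1r.
Qed.

Lemma cfrac_defined_step : cfrac_defined nn c e z t.
Proof.
have N0 := num_normal_gt0 nn_normal.
split=> [[|[|k]]|[|k]] // hk.
- rewrite subn1 cfrac_den1 invr_eq0; exact: f_neq0.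
- have [_ /(_ (N - k.+2)%N) H] := @cfrac_denE (N - k.+1) k ltac:(lia).
  by have [] := H ltac:(lia).
- have [_ /(_ (N - k.+2)%N) H] := @cfrac_denE (N - k.+1) k ltac:(lia).
  have [_ ->] := H ltac:(lia).
  by rewrite invr_eq0; apply: lf_neq0; lia.
Qed.

Lemma cfrac_step : cfrac nn c e z t = f 0%N.
Proof. by rewrite /cfrac cfrac_den1 div1r invrK. Qed.

(** [y_(2j-1) + y_(2j) * den_(j+1)], where [den_(j+1)] is the [j + 1]-st
denominator of the continued fraction and [y] a solution of the recurrences. *)
Definition stieltjes_tail (y : {poly R} * {poly R}) (j : nat) : C :=
  ceval (stieltjes_rec nn c e y j).1 z +
  ceval (stieltjes_rec nn c e y j).2 z * cfrac_den nn c e z t (N - j.+1) j.+1.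

Lemma ceval_stieltjes_odd y j :
  ceval (stieltjes_rec nn c e y j.+1).1 z =
  ceval (stieltjes_rec nn c e y j).1 z -
    z * ceval (m j.+1) z * ceval (stieltjes_rec nn c e y j).2 z.
Proof.
rewrite /=; case: (stieltjes_rec nn c e y j) => p q /=.
by rewrite /ceval rmorphB !rmorphM /= map_polyX hornerD hornerN !hornerM hornerX.
Qed.

Lemma ceval_stieltjes_even y j :
  ceval (stieltjes_rec nn c e y j.+1).2 z =
  ceval (stieltjes_rec nn c e y j).2 z +
    (l j.+1)%:C * ceval (stieltjes_rec nn c e y j.+1).1 z.
Proof.
rewrite /=; case: (stieltjes_rec nn c e y j) => p q /=.
by rewrite /ceval rmorphD /= map_polyZ hornerD hornerZ.
Qed.

(** The factor does not depend on the initial values [y]; hence the ratio of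
the tails of the two solutions is constant. *)
Lemma stieltjes_tailS y j : (j.+1 < N)%N ->
  let den := cfrac_den nn c e z t (N - j.+2) j.+2 in
  stieltjes_tail y j.+1 = den * ((l j.+1)%:C + 1 / den) * stieltjes_tail y j.
Proof.
move=> ltjN den; have [Hden Hl] := cfrac_defined_step.
have den0 : den != 0 by apply: Hden; lia.
have l0 : (l j.+1)%:C + 1 / den != 0 by apply: (Hl j.+1); lia.
rewrite /stieltjes_tail -/den ceval_stieltjes_even.
have -> : (N - j.+1 = (N - j.+2).+1)%N by lia.
have -> : cfrac_den nn c e z t (N - j.+2).+1 j.+1 =
  - z * ceval (m j.+1) z + 1 / ((l j.+1)%:C + 1 / den) by [].
rewrite ceval_stieltjes_odd; have l1 : (l j.+1)%:C * den + 1 != 0.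
  by have := mulf_neq0 l0 den0; rewrite mulrDl div1r mulVf.
move: (ceval _ _) (ceval _ _) (ceval _ _) => p q w.
move: den (l j.+1)%:C den0 l1 {Hden Hl l0} => x x' x0 l1.
by field; rewrite x0 l1.
Qed.

Lemma stieltjes_tailE j : (j < N)%N ->
  stieltjes_tail (0, 1) j != 0 /\
  stieltjes_tail (1, 0) j = f 0%N * stieltjes_tail (0, 1) j.
Proof.
have N0 := num_normal_gt0 nn_normal.
have f0 := f_neq0 N0.
elim: j => [|j IH] ltjN.
  rewrite /stieltjes_tail /= subn1 cfrac_den1 /ceval !(rmorph0, rmorph1) !hornerE.
  by rewrite invr_eq0 divff.
have [h0 h1] := IH (ltnW ltjN).
rewrite !stieltjes_tailS // h1; split; last by rewrite mulrCA.
have [Hden Hl] := cfrac_defined_step.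
by apply: mulf_neq0 => //; apply: mulf_neq0; [apply: Hden|apply: Hl]; lia.
Qed.

Hypothesis t_neq0 : t != Some 0.

Lemma linfrac_step :
  linfrac_den nn c e z t != 0 /\ linfrac nn c e z t = f 0%N.
Proof.
have N0 := num_normal_gt0 nn_normal.
have [h0 h1] := @stieltjes_tailE N.-1 ltac:(lia).
have tailE y : stieltjes_tail y N.-1 =
    ceval (stieltjes_rec nn c e y N).1 z +
    ceval (stieltjes_rec nn c e y N.-1).2 z * param_inv t.
  have [k Ek] : exists k, N = k.+1 by exists N.-1; lia.
  rewrite /stieltjes_tail Ek /= subnn.
  have -> : cfrac_den nn c e z t 0 k.+1 = - z * ceval (m k.+1) z + param_inv t by [].
  by have := ceval_stieltjes_odd y k => /= ->; ring.
rewrite /linfrac /linfrac_num /linfrac_den /P_odd /P_even /Q_odd /Q_even.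
move: h0 h1; rewrite !tailE.
case: t t_neq0 => [w|] /=; last by move=> _; rewrite !mulr0 !addr0 => h0 ->; rewrite mulfK.
move=> wn; have w0 : w != 0 by apply: contraNneq wn => ->.
set po := ceval _ _; set pe := ceval _ _; set qo := ceval _ _; set qe := ceval _ _.
move=> h0 h1; have E1 : po * w + pe = (po + pe / w) * w by rewrite mulrDl divfK.
have E2 : qo * w + qe = (qo + qe / w) * w by rewrite mulrDl divfK.
have h2 : (po + pe / w) * w != 0 by apply: mulf_neq0.
by rewrite E1 E2 h1 -[_ * _ * w]mulrA mulfK.
Qed.

End ContinuedFraction.

(** * Truncated moment series *)

Section MomentPoly.
Variable F : fieldType.

Lemma size_moment_poly (c : nat -> F) M v : (forall i, (i < v.-1)%N -> c i = 0) ->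
  (size (moment_poly M c) <= (M - v).+1)%N.
Proof.
move=> c_lt; apply/leq_sizeP => j hj; rewrite coef_poly; case: ifP => // ltj.
by rewrite c_lt //; lia.
Qed.

Lemma moment_polyD (c : nat -> F) M n : exists2 q : {poly F}, (size q <= n)%N &
  moment_poly (M + n) c = 'X^n * moment_poly M c + q.
Proof.
exists (\poly_(i < n) c ((M + n).-1 - i)%N); first exact: size_poly.
apply/polyP => i; rewrite coefD coefXnM !coef_poly.
have [ltin|lein] := ltnP i n; first by rewrite add0r ifT //; lia.
rewrite addr0; have -> : (i < M + n)%N = (i - n < M)%N by lia.
by case: ifP => // _; congr c; lia.
Qed.

End MomentPoly.

(** * Limits in Stolz domains *)

Section StolzFilter.
Variables (R : realType) (theta : R).
Local Notation C := (R[i] : numFieldType).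

Lemma stolz_infty_norm (M : R) : \forall z \near stolz_infty theta, M%:C < `|z|.
Proof. by exists M. Qed.

Lemma stolz_infty_neq0 : \forall z \near stolz_infty theta, z != 0.
Proof.
by have := stolz_infty_norm 0; apply: filterS => z; rewrite normr_gt0.
Qed.

Lemma stolz_infty_half_plane :
  \forall z \near stolz_infty theta, upper_half_plane z.
Proof. by exists 0 => // z _ []. Qed.

Lemma stolz_infty_inv : tends (stolz_infty theta) (fun z : C => z^-1) 0.
Proof.
apply/cvgr0Pnorm_le => /= eps eps0.
have eR : eps = (complex.Re eps)%:C.
  by have /complex_realP[x ->] := gtr0_real eps0.
have e0 : 0 < complex.Re eps by move: eps0; rewrite {1}eR ltcR.
have := stolz_infty_norm (complex.Re eps)^-1; apply: filterS => z.
rewrite fmorphV /= -eR => h.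
rewrite normfV -[eps]invrK lef_pV2 ?posrE ?invr_gt0 //; first exact: ltW.
by apply: lt_trans h; rewrite invr_gt0.
Qed.

End StolzFilter.

Lemma stolz_littleo_tends (R : realType) (f g : R[i] -> R[i]) theta :
  0 < theta <= pi / 2 -> stolz_littleo f g ->
  (\forall z \near stolz_infty theta, g z != 0) ->
  tends (stolz_infty theta) (fun z : (R[i] : numFieldType) => f z / g z) 0.
Proof.
move=> ht /(_ theta ht) /eqoP H g0.
apply/cvgr0Pnorm_le => /= eps eps0; near=> z.
have gz : g z != 0 by near: z.
rewrite normrM normfV ler_pdivrMr ?normr_gt0 //.
by near: z; exact: H.
Unshelve. all: by end_near. Qed.

Lemma tends_stolz_littleo (R : realType) (f g : R[i] -> R[i]) :
  (forall theta, 0 < theta <= pi / 2 ->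
    (\forall z \near stolz_infty theta, g z != 0) /\
    tends (stolz_infty theta) (fun z : (R[i] : numFieldType) => f z / g z) 0) ->
  stolz_littleo f g.
Proof.
move=> H theta ht; have [g0 /cvgr0Pnorm_le Ht] := H theta ht.
apply/eqoP => eps eps0; near=> z.
have gz : g z != 0 by near: z.
rewrite -ler_pdivrMr ?normr_gt0 // -normfV -normrM.
by near: z; exact: Ht.
Unshelve. all: by end_near. Qed.

(** * The one-dimensional problem *)

Section OneDimensional.
Variables (R : realType) (nn : nat) (c : nat -> R) (e : R).
Hypothesis nn_normal : is_normal_index nn c nn.
Hypothesis Hreg : regular nn c.
Variable f : R[i] -> R[i].

Local Notation N := (num_normal nn c).
Local Notation C := R[i].
Local Notation a := (patom_a nn c e).
Local Notation b := (patom_b nn c).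
Local Notation d := (satom_d nn c e).
Local Notation l := (satom_l nn c e).
Local Notation ce := (derived_seq_ext nn c e).
Local Notation nu := (nu nn c).
Local Notation ni := (normal_index nn c).

Hypothesis Hf : stolz_littleo
  (fun z => f z - (- \sum_(i < (2 * nn - 2).+1) (c i)%:C / z ^+ i.+1))
  (fun z => 1 / z ^+ (2 * nn - 2).+1).

(** The tails [f_k] of the P-fraction of [f]:
[f_k = - b_k / (a_k + f_(k+1))]. *)
Fixpoint pfrac_tail (k : nat) (z : C) : C :=
  if k is k'.+1 then - (b k')%:C / pfrac_tail k' z - ceval (a k') z else f z.

(** The number of terms of the [k]-th derived sequence which the moments of
[f] determine. *)
Let order (k : nat) : nat := (2 * (nn - ni k)).-1.

Local Notation toC := (map_poly (real_complex R)).

Lemma order_ge k : (k < N)%N -> (nu k.+1 <= nn - ni k)%N.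
Proof.
move=> ltkN; have := normal_index_le nn_normal ltkN.
rewrite normal_indexS //; lia.
Qed.

Lemma orderS k : (k.+1 < N)%N -> order k = (order k.+1 + 2 * nu k.+1)%N.
Proof.
move=> ltkN; have := order_ge ltkN; have := nu_gt0 ltkN.
by rewrite /order (normal_indexS (ltnW ltkN)); lia.
Qed.

Lemma order_last : order N.-1 = (2 * nu N).-1.
Proof.
have N0 := num_normal_gt0 nn_normal.
have [k Ek] : exists k, N = k.+1 by exists N.-1; lia.
have := @normal_indexS _ nn c k; rewrite -Ek leqnn => /(_ isT).
rewrite normal_index_last // /order Ek /= -Ek => E; lia.
Qed.

(** The arbitrary value [e] is not among the terms that are determined. *)
Lemma derived_seq_ext_known k i : (k < N)%N -> (i < order k)%N ->
  ce k i = derived_seq nn c k i.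
Proof.
move=> ltkN lti; have [lt2|ge2] := ltnP k.+1 N; first by rewrite derived_seq_extE.
have EN : N = k.+1 by lia.
rewrite derived_seq_ext_low //.
by have := order_last; rewrite EN /= => E; rewrite E in lti; lia.
Qed.

Lemma expansion_tail0 theta : 0 < theta <= pi / 2 ->
  has_expansion (stolz_infty theta) (pfrac_tail 0) (order 0)
    (toC (moment_poly (order 0) (ce 0))).
Proof.
move=> ht; have znz := stolz_infty_neq0 theta.
have K0 : order 0 = (2 * nn - 2).+1.
  by have := nn_gt0 nn_normal; rewrite /order /normal_index /=; lia.
have g0 : \forall z \near stolz_infty theta, 1 / z ^+ (2 * nn - 2).+1 != 0.
  by apply: filterS znz => z z0; rewrite div1r invr_eq0 expf_neq0.
have T := stolz_littleo_tends ht Hf g0.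
apply: (tends_near_eq znz T); apply: nearW => z z0 /=.
rewrite -K0 div1r invrK opprK mulrDl mulrC; congr (_ + _).
have szp : (size (toC (moment_poly (order 0) (ce 0))) <= order 0)%N.
  by rewrite size_map_poly size_poly.
(* The coefficients of moment_poly are in reverse order. *)
rewrite (horner_coef_wide _ szp) (reindex_inj rev_ord_inj) mulr_suml /=.
apply: eq_bigr => i _; have hi := ltn_ord i.
rewrite coef_map coef_poly ltn_ord /= derived_seq_ext_known ?num_normal_gt0 //; last by lia.
have -> : ((order 0).-1 - i = order 0 - i.+1)%N by lia.
rewrite mulrAC -mulrA; congr (_ * _).
have {1}-> : order 0 = (i + (order 0 - i.+1).+1)%N by lia.
by rewrite exprD mulfK ?expf_neq0.
Qed.

Section Tail.
Variable theta : R.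
Hypothesis htheta : 0 < theta <= pi / 2.
Let znz := stolz_infty_neq0 theta.
Let zinf := stolz_infty_inv theta.

Let sizes k : (k < N)%N ->
  [/\ (nu k.+1 <= order k)%N,
      (size (toC (moment_poly (order k) (ce k))) <= (order k - nu k.+1).+1)%N &
      (toC (moment_poly (order k) (ce k)))`_(order k - nu k.+1) = (b k)%:C].
Proof.
move=> ltkN; have v0 := nu_gt0 ltkN; have := order_ge ltkN.
rewrite /order => h; split; first by lia.
  by rewrite size_map_poly size_moment_poly // => i; apply: derived_seq_ext_lt.
rewrite coef_map coef_poly ifT /=; last by lia.
rewrite -(derived_seq_ext_b e nn_normal ltkN); congr ((ce k _)%:C); lia.
Qed.

(** [expansion_step] for the [k]-th tail. *)
Let step k : (k < N)%N ->
  has_expansion (stolz_infty theta) (pfrac_tail k) (order k)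
    (toC (moment_poly (order k) (ce k))) ->
  tends (stolz_infty theta) (fun z : (C : numFieldType) =>
    z ^+ order k / z ^+ (2 * nu k.+1) * (pfrac_tail k.+1 z +
      (toC (moment_poly (order k) (pfrac_next (ce k) (nu k.+1)))).[z] / z ^+ order k)) 0.
Proof.
move=> ltkN H; have [lev szp pb] := sizes ltkN.
have v0 := nu_gt0 ltkN.
have b0 : (b k)%:C != 0 :> C by rewrite fmorph_eq0 patom_b_neq0.
apply: (expansion_step (p := toC (moment_poly (order k) (ce k))) znz zinf lev szp pb b0 _ _ _ H).
- by rewrite size_map_poly patom_aE // (leq_trans (size_scale_leq _ _)) // size_poly.
- by rewrite size_map_poly size_poly.
rewrite patom_aE //.
have := size_pfrac_step v0 (fun i => @derived_seq_ext_lt R nn c e nn_normal k i ltkN) _ lev.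
rewrite derived_seq_ext_b // patom_b_neq0 // => /(_ isT).
rewrite -(size_map_poly (real_complex R)).
move: (pfrac_quot (ce k) (nu k.+1)) => q.
by rewrite !(rmorphB, rmorphM) /= map_polyZ /= !map_polyXn.
Qed.

Lemma expansion_tail k : (k < N)%N ->
  has_expansion (stolz_infty theta) (pfrac_tail k) (order k)
    (toC (moment_poly (order k) (ce k))).
Proof.
elim: k => [|k IH] ltkN; first exact: expansion_tail0.
have H := step (ltnW ltkN) (IH (ltnW ltkN)).
have oS := orderS ltkN.
have [q szq Eq] := moment_polyD (pfrac_next (ce k) (nu k.+1)) (order k.+1) (2 * nu k.+1).
rewrite oS in H.
have E1 : toC (moment_poly (order k.+1 + 2 * nu k.+1) (pfrac_next (ce k) (nu k.+1))) =
   'X^(2 * nu k.+1) * toC (moment_poly (order k.+1) (pfrac_next (ce k) (nu k.+1))) + toC q.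
  by rewrite Eq rmorphD rmorphM /= map_polyXn.
have szq' : (size (toC q) <= 2 * nu k.+1)%N by rewrite size_map_poly.
suff -> : moment_poly (order k.+1) (ce k.+1) =
    moment_poly (order k.+1) (pfrac_next (ce k) (nu k.+1)).
  exact: (expansion_step_next znz zinf E1 szq' H).
apply/polyP => i; rewrite !coef_poly.
case: ifP => // lti.
have Epn : pfrac_next (ce k) (nu k.+1) = pfrac_next (derived_seq nn c k) (nu k.+1).
  by congr pfrac_next; apply/funext => j; rewrite derived_seq_extE.
have ltk := ltnW ltkN.
rewrite Epn -derived_seqS ?nu_gt0 ?patom_b_neq0 //; last first.
  by move=> j; apply: derived_seq_lt.
by rewrite derived_seq_ext_known //; lia.
Qed.

Lemma pfrac_tail_neq0 : \forall z \near stolz_infty theta,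
  forall k, (k < N)%N -> pfrac_tail k z != 0.
Proof.
have H : \forall z \near stolz_infty theta, forall k : 'I_N, pfrac_tail k z != 0.
  apply: filter_forall => k; have ltkN := ltn_ord k.
  have [lev szp pb] := sizes ltkN.
  apply: (has_expansion_neq0 znz zinf lev szp _ (expansion_tail ltkN)).
  by rewrite pb fmorph_eq0 patom_b_neq0.
by apply: filterS H => z Hz k ltkN; apply: (Hz (Ordinal ltkN)).
Qed.

Lemma satom_linv_tail_neq0 : \forall z \near stolz_infty theta,
  forall k, (k.+1 < N)%N ->
  (satom_linv nn c e k.+1)%:C - (d k.+1)%:C * pfrac_tail k.+1 z != 0.
Proof.
have H : \forall z \near stolz_infty theta, forall k : 'I_N.-1,
  (satom_linv nn c e k.+1)%:C - (d k.+1)%:C * pfrac_tail k.+1 z != 0.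
  apply: filter_forall => k; have ltkN : (k.+1 < N)%N by have := ltn_ord k; lia.
  have szp : (size (toC (moment_poly (order k.+1) (ce k.+1))) <= order k.+1)%N.
    by rewrite size_map_poly size_poly.
  have T : tends (stolz_infty theta) (pfrac_tail k.+1 : C -> (C : numFieldType)) 0.
    exact: (has_expansion_tends0 znz zinf szp (expansion_tail ltkN)).
  have L : tends (stolz_infty theta) (fun z : (C : numFieldType) =>
      (satom_linv nn c e k.+1)%:C - (d k.+1)%:C * pfrac_tail k.+1 z)
      ((satom_linv nn c e k.+1)%:C - (d k.+1)%:C * 0).
    by apply: tendsB; [exact: tends_cst|apply: tendsM T; exact: tends_cst].
  rewrite mulr0 subr0 in L; apply: (tends_neq0 L).
  have [_ /(_ ltkN) [l0 _]] := satomE e nn_normal Hreg (ltnW ltkN).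
  by rewrite fmorph_eq0 /satom_linv invr_eq0.
apply: filterS H => z Hz k ltkN.
have lt' : (k < N.-1)%N by lia.
exact: (Hz (Ordinal lt')).
Qed.

Lemma pfrac_tail_last :
  tends (stolz_infty theta) (fun z : (C : numFieldType) => pfrac_tail N z / z) 0.
Proof.
have N0 := num_normal_gt0 nn_normal.
have [k Ek] : exists k, N = k.+1 by exists N.-1; lia.
have ltkN : (k < N)%N by rewrite Ek.
have ok : order k = (2 * nu N).-1 by rewrite -order_last Ek.
have H := step ltkN (expansion_tail ltkN).
rewrite ok -Ek in H.
have v0 : (0 < nu N)%N by rewrite Ek nu_gt0.
apply: (expansion_step_last znz zinf v0 _ H).
by rewrite size_map_poly size_poly.
Qed.

End Tail.

(** The reciprocal of the parameter, obtained by solving for it in the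
innermost denominator of the continued fraction. *)
Definition parameter_inv (z : C) : C := - (satom_linv nn c e N.-1)%:C
  - (d N)%:C * ((a N.-1).[0])%:C - (d N)%:C * pfrac_tail N z.

(** The parameter itself, [None] being infinity. *)
Definition parameter (z : C) : option C :=
  if parameter_inv z == 0 then None else Some (parameter_inv z)^-1.

Lemma param_inv_parameter z : param_inv (parameter z) = parameter_inv z.
Proof. by rewrite /parameter; case: eqP => [->|_] //=; rewrite invrK. Qed.

Lemma parameter_neq0 z : parameter z != Some 0.
Proof.
rewrite /parameter; case: ifP => // /negbT h.
by apply/negP => /eqP [] /eqP; rewrite invr_eq0 (negbTE h).
Qed.

Lemma inv_littleo_parameter : inv_littleo_id parameter.
Proof.
split=> [theta _|]; first by apply: nearW => z; exact: parameter_neq0.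
apply: tends_stolz_littleo => theta ht; split; first exact: stolz_infty_neq0.
have znz := stolz_infty_neq0 theta.
have zinf := stolz_infty_inv theta.
have T := pfrac_tail_last ht.
set k := - (satom_linv nn c e N.-1)%:C - (d N)%:C * ((a N.-1).[0])%:C.
have L : tends (stolz_infty theta) (fun z : (C : numFieldType) =>
    k * z^-1 - (d N)%:C * (pfrac_tail N z / z)) (k * 0 - (d N)%:C * 0).
  by apply: tendsB; [apply: tendsM zinf|apply: tendsM T]; exact: tends_cst.
rewrite !mulr0 subr0 in L.
apply: (tends_near_eq znz L); apply: nearW => z _.
by rewrite param_inv_parameter /parameter_inv -/k [RHS]mulrBl mulrA.
Qed.

Lemma parameter_correct theta : 0 < theta <= pi / 2 ->
  \forall z \near stolz_infty theta,
    [/\ cfrac_defined nn c e z (parameter z), cfrac nn c e z (parameter z) = f z,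
        linfrac_den nn c e z (parameter z) != 0 &
        linfrac nn c e z (parameter z) = f z].
Proof.
move=> ht; have := pfrac_tail_neq0 ht; have := satom_linv_tail_neq0 ht.
apply: filterS2 => z H1 H2.
pose F k := pfrac_tail k z.
have FS k : (k < N)%N -> F k.+1 = - (b k)%:C / F k - ceval (a k) z by [].
have tE := param_inv_parameter z.
have [h1 h2] := linfrac_step nn_normal Hreg FS H2 H1 tE (parameter_neq0 z).
split=> //.
- exact: (cfrac_defined_step nn_normal Hreg FS H2 H1 tE).
- exact: (cfrac_step nn_normal Hreg FS H2 H1 tE).
Qed.

End OneDimensional.

Theorem theorem4p1 (R : realType) (n nn : nat) (hn : (2 <= n)%N)
    (hnn : (1 <= nn)%N)
    (s : 'I_(2 * nn - 2).+1 -> multi_index n (2 * nn - 2) -> R)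
    (e : multi_index n (2 * nn - 2) -> R)
    (hnormal : forall J, is_normal_index nn (assoc_seq s J) nn)
    (hregular : forall J, regular nn (assoc_seq s J))
    (F : R[i] -> ('I_n.-1 -> R[i]) -> R[i])
    (hF : MP_solution s F) :
  exists tau : multi_index n (2 * nn - 2) -> R[i] -> option R[i],
    (forall J, inv_littleo_id (tau J)) /\
    (forall theta : R, 0 < theta <= pi / 2 ->
       \forall z1 \near stolz_infty theta,
         (forall J, cfrac_defined nn (assoc_seq s J) (e J) z1 (tau J z1)) /\
         (forall z : 'I_n.-1 -> R[i], (forall k, z k != 0) ->
            F z1 z = \sum_J monomial_weight J z *
                       cfrac nn (assoc_seq s J) (e J) z1 (tau J z1))) /\
    (forall theta : R, 0 < theta <= pi / 2 ->
       \forall z1 \near stolz_infty theta,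
         (forall J, linfrac_den nn (assoc_seq s J) (e J) z1 (tau J z1) != 0) /\
         (forall z : 'I_n.-1 -> R[i], (forall k, z k != 0) ->
            F z1 z = \sum_J monomial_weight J z *
                       linfrac nn (assoc_seq s J) (e J) z1 (tau J z1))).
Proof.
case: hF => FJ [HF HJ].
exists (fun J => parameter nn (assoc_seq s J) (e J) (FJ J)).
pose good J z1 (t := parameter nn (assoc_seq s J) (e J) (FJ J) z1) :=
  [/\ cfrac_defined nn (assoc_seq s J) (e J) z1 t,
      cfrac nn (assoc_seq s J) (e J) z1 t = FJ J z1,
      linfrac_den nn (assoc_seq s J) (e J) z1 t != 0 &
      linfrac nn (assoc_seq s J) (e J) z1 t = FJ J z1].
have near_all theta : 0 < theta <= pi / 2 -> \forall z1 \near stolz_infty theta,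
    upper_half_plane z1 /\ forall J, good J z1.
  move=> ht; have H : \forall z1 \near stolz_infty theta, forall J, good J z1.
    apply: filter_forall => J.
    exact: (parameter_correct (e J) (hnormal J) (hregular J) (HJ J) ht).
  exact: filterI (stolz_infty_half_plane theta) H.
split; first by move=> J; exact: (inv_littleo_parameter (e J) (hnormal J) (HJ J)).
split=> theta ht; have := near_all theta ht; apply: filterS => z1 [h1 h2].
  split=> [J|z z0]; first by have [] := h2 J.
  rewrite HF //; apply: eq_bigr => J _; have [_ -> _ _] := h2 J.
  by rewrite /monomial_weight div1r mulrC.
split=> [J|z z0]; first by have [] := h2 J.
rewrite HF //; apply: eq_bigr => J _; have [_ _ _ ->] := h2 J.
by rewrite /monomial_weight div1r mulrC.
Qed.
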